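(* Let $(M,g(\cdot),\overline f(\cdot))$ be a gradient steady soliton solution of the Ricci flow and let $\{\Sigma_t\}$ be the mean curvature flow, in $(M,g(\cdot))$, of a mean curvature soliton (so that each $\Sigma_t$ is a mean curvature soliton, i.e. satisfies $H+e_0\overline f(t)=0$). Then on $\Sigma_t$, $$\frac{\partial H}{\partial t} - 2\langle\widehat\nabla\overline f,\widehat\nabla H\rangle + A(\widehat\nabla\overline f,\widehat\nabla\overline f) + 2R^{0i}\widehat\nabla_i\overline f - \frac12\nabla_0R - HR_{00} = 0.$$
   Context: A gradient steady soliton solution $(M,g(\cdot),\overline f(\cdot))$, defined for $t\in\mathbb R$, means: (1) $\frac{\partial g}{\partial t}=-2\operatorname{Ric}$; (2) at each time, $R_{\alpha\beta}+\nabla_\alpha\nabla_\beta\overline f=0$; (3) $\frac{\partial\overline f}{\partial t}=|\nabla\overline f|^2$. At a given time $t$, a hypersurface $\Sigma_t$ in $M$ is a mean curvature soliton if $H+e_0\overline f(t)=0$ on $\Sigma_t$ (this does not depend on the choice of local unit normal $e_0$). Here all quantities are with respect to $g(t)$, $e_0$ is a local unit normal to $\Sigma_t$, $A(X,Y)=g(e_0,\nabla_XY)$ is the second fundamental form, and $H=g^{ij}A_{ij}$ is the mean curvature. Mean curvature flow means that the hypersurfaces $\Sigma_t$, parametrized by immersions of a fixed $(n-1)$-manifold $\Sigma$, $n=\dim M$, evolve by $\frac{dx}{dt}=He_0$, and $\frac{\partial H}{\partial t}$ is the time derivative at a fixed point of $\Sigma$. If $\{\phi_t\}$ is the family of diffeomorphisms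 generated by the time-independent vector field $-\nabla_{g(t)}\overline f(t)$ with $\phi_0=\mathrm{Id}$, the ensuing mean curvature flow of a time-zero mean curvature soliton $\Sigma_0$ consists of mean curvature solitons and differs from $\{\phi_t(\Sigma_0)\}$ by hypersurface diffeomorphisms. $\widehat\nabla$ is the Levi-Civita connection (gradient) of the induced metric on $\Sigma_t$; $R_{\alpha\beta}$ and $R$ are the Ricci and scalar curvature of $(M,g(t))$; index $0$ denotes the direction $e_0$ and Latin indices the directions tangent to $\Sigma_t$, so $R^{0i}\widehat\nabla_i\overline f=\operatorname{Ric}(e_0,\widehat\nabla\overline f)$, $\nabla_0R=e_0R$, $R_{00}=\operatorname{Ric}(e_0,e_0)$. *)

(* Defs.v *)
From HB Require Import structures.
From mathcomp Require Import all_boot all_order all_algebra.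
From mathcomp Require Import all_classical all_reals all_analysis.
Import Order.TTheory GRing.Theory Num.Theory.
Import numFieldNormedType.Exports.

Set Implicit Arguments.
Unset Strict Implicit.
Unset Printing Implicit Defensive.

Local Open Scope ring_scope.
Local Open Scope classical_set_scope.

(* MathComp-Analysis, over an arbitrary [R : realType].

   Tensors are given classically, by their components in the charts of an
   atlas; every tensor equation is required in every chart.  Vectors are rows,
   so the Jacobian ['J X u] has the coordinate tangent vector d_i X as its
   i-th row. *)

(** * Smooth maps *)

(* C^k on an open set U.  On finite-dimensional spaces, the only ones used
   below, asking all directional derivatives of a differentiable map to be
   C^(k-1) is the usual notion. *)
Fixpoint Ck (R : realType) (V W : normedModType R) (k : nat) (U : set V)
    (f : V -> W) : Prop :=
  if k is k'.+1 then
    (forall x, U x -> differentiable f x) /\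
    (forall v, Ck k' U (fun x => 'D_v f x))
  else forall x, U x -> {for x, continuous f}.

Definition smooth_on (R : realType) (V W : normedModType R) (U : set V)
    (f : V -> W) : Prop := forall k, Ck k U f.

(** * Manifolds *)

(* [par c] is the inverse of the chart [coord c : dom c -> R^n]; the values of
   [coord c] off [dom c] and of [par c] off the image are irrelevant. *)
Record manifold (R : realType) (n : nat) := Manifold {
  points :> topologicalType;
  manifold_hausdorff : hausdorff_space points;
  manifold_second_countable : @second_countable points;
  chart : Type;
  dom : chart -> set points;
  coord : chart -> points -> 'rV[R]_n;
  par : chart -> 'rV[R]_n -> points;
  dom_open : forall c, open (dom c);
  dom_cover : forall p, exists c, dom c p;
  coordK : forall c p, dom c p -> par c (coord c p) = p;
  coord_continuous : forall c p, dom c p -> {for p, continuous (coord c)};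
  img_open : forall c, open (coord c @` dom c);
  par_continuous : forall c x, (coord c @` dom c) x ->
    {for x, continuous (par c)};
  transition_smooth : forall c c',
    smooth_on (coord c @` (dom c `&` dom c')) (coord c' \o par c) }.

Definition img (R : realType) (n : nat) (M : manifold R n) (c : chart M)
  : set 'rV[R]_n := coord c @` dom c.

Definition bil (R : realType) (n : nat) (B : 'M[R]_n) (u v : 'rV[R]_n) : R :=
  (u *m B *m v^T) 0 0.

(* A smooth family g(t), t in R, of Riemannian metrics: [metric g c t x] is
   the matrix of components of g(t) in the chart c at the point with
   coordinates x. *)
Record metric_family (R : realType) (n : nat) (M : manifold R n) :=
    MetricFamily {
  metric :> chart M -> R -> 'rV[R]_n -> 'M[R]_n;
  metric_sym : forall c t x, img c x -> (metric c t x)^T = metric c t x;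
  metric_posdef : forall c t x, img c x ->
    forall v, v != 0 -> 0 < bil (metric c t x) v v;
  metric_smooth : forall c,
    smooth_on [set z : R * 'rV[R]_n | img c z.2]
              (fun z : R * 'rV[R]_n => metric c z.1 z.2);
  metric_change : forall c c' t p, dom c p -> dom c' p ->
    let T := 'J (coord c' \o par c) (coord c p) in
    metric c t (coord c p) = T *m metric c' t (coord c' p) *m T^T }.

(** * Riemannian geometry in one chart, for a metric G on an open set of R^n *)

Section LocalGeometry.
Variables (R : realType) (n : nat).
Implicit Types (G : 'rV[R]_n -> 'M[R]_n) (f : 'rV[R]_n -> R) (x : 'rV[R]_n).

Definition pd (i : 'I_n) f x : R := 'D_(delta_mx 0 i) f x.

(* Gamma^k_ij *)
Definition christoffel G (k i j : 'I_n) x : R :=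
  2^-1 * \sum_l invmx (G x) k l *
    (pd i (fun y => G y j l) x + pd j (fun y => G y i l) x
     - pd l (fun y => G y i j) x).

(* dx^l (Rm(d_i, d_j) d_k), with
   Rm(X, Y) = nabla_X nabla_Y - nabla_Y nabla_X - nabla_[X, Y] *)
Definition riemann G (i j k l : 'I_n) x : R :=
  pd i (christoffel G l j k) x - pd j (christoffel G l i k) x
  + \sum_a (christoffel G l i a x * christoffel G a j k x
            - christoffel G l j a x * christoffel G a i k x).

(* Positive on round spheres. *)
Definition ricci G x : 'M[R]_n :=
  \matrix_(j, k) \sum_i riemann G i j k i x.

Definition scalar_curvature G x : R :=
  \sum_i \sum_j invmx (G x) i j * ricci G x i j.

Definition hessian G f x : 'M[R]_n :=
  \matrix_(i, j) (pd i (pd j f) x - \sum_k christoffel G k i j x * pd k f x).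

Definition gradient G f x : 'rV[R]_n :=
  \row_k \sum_l invmx (G x) k l * pd l f x.

End LocalGeometry.

(** * Hypersurfaces in one chart: X is a parametrized immersion into (R^n, G) *)

Section LocalHypersurface.
Variables (R : realType) (m n : nat).
Implicit Types (G : 'rV[R]_n -> 'M[R]_n) (X : 'rV[R]_m -> 'rV[R]_n).
Implicit Types (u : 'rV[R]_m) (N : 'rV[R]_n).

Definition induced_metric G X u : 'M[R]_m :=
  'J X u *m G (X u) *m ('J X u)^T.

Definition unit_normal G X u N : Prop :=
  bil (G (X u)) N N = 1 /\ forall i, bil (G (X u)) N (row i ('J X u)) = 0.

(* nabla_(d_i X) (d_j X), the Levi-Civita derivative along X *)
Definition cov_deriv G X (i j : 'I_m) u : 'rV[R]_n :=
  \row_k (pd i (fun y => 'J X y j k) u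
          + \sum_a \sum_b christoffel G k a b (X u) * 'J X u i a * 'J X u j b).

(* A(X, Y) = g(N, nabla_X Y) *)
Definition second_form G X u N : 'M[R]_m :=
  \matrix_(i, j) bil (G (X u)) N (cov_deriv G X i j u).

Definition mean_curvature G X u N : R :=
  \sum_i \sum_j invmx (induced_metric G X u) i j * second_form G X u N i j.

End LocalHypersurface.

(** * Gradient steady solitons *)

Record gradient_steady_soliton (R : realType) (n : nat) (M : manifold R n)
    (g : metric_family M) (f : R -> M -> R) : Prop := GradientSteadySoliton {
  potential_smooth : forall c : chart M,
    smooth_on [set z : R * 'rV[R]_n | img c z.2]
              (fun z : R * 'rV[R]_n => f z.1 (par c z.2));
  ricci_flow : forall (c : chart M) t x, img c x ->
    (fun s => g c s x)^`() t = - 2%:R *: ricci (g c t) x;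
  soliton_equation : forall (c : chart M) t x, img c x ->
    ricci (g c t) x + hessian (g c t) (f t \o par c) x = 0;
  potential_flow : forall (c : chart M) t x, img c x ->
    let df := gradient (g c t) (f t \o par c) x in
    (fun s => f s (par c x))^`() t = bil (g c t x) df df }.

(** * Immersed hypersurfaces and mean curvature flow *)

Section Hypersurfaces.
Variables (R : realType) (m : nat) (M : manifold R m.+1) (S : manifold R m).

(* A map S -> M in the charts c of M and d of S, and the set on which this
   representative is meaningful. *)
Definition rep (c : chart M) (d : chart S) (X : S -> M)
  : 'rV[R]_m -> 'rV[R]_m.+1 := fun u => coord c (X (par d u)).

Definition rep_dom (c : chart M) (d : chart S) (X : S -> M)
  : set 'rV[R]_m := [set u | img d u /\ dom c (X (par d u))].

Definition flow_dom (J : set R) (F : R -> S -> M) (c : chart M) (d : chart S)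
  : set (R * 'rV[R]_m) := [set z | J z.1 /\ rep_dom c d (F z.1) z.2].

Definition mean_curvature_soliton (g : chart M -> 'rV[R]_m.+1 -> 'M[R]_m.+1)
    (f : M -> R) (X : S -> M) : Prop :=
  forall (c : chart M) (d : chart S) u N, rep_dom c d X u ->
    unit_normal (g c) (rep c d X) u N ->
    mean_curvature (g c) (rep c d X) u N
    + 'D_N (f \o par c) (rep c d X u) = 0.

Record mean_curvature_flow (g : metric_family M) (J : set R)
    (F : R -> S -> M) : Prop := MeanCurvatureFlow {
  flow_interval : is_interval J;
  flow_open : open J;
  flow_continuous : forall t p, J t ->
    {for (t, p), continuous (fun z : R * S => F z.1 z.2)};
  flow_smooth : forall c d,
    smooth_on (flow_dom J F c d)
              (fun z : R * 'rV[R]_m => rep c d (F z.1) z.2);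
  flow_immersion : forall c d t u, J t -> rep_dom c d (F t) u ->
    row_free ('J (rep c d (F t)) u);
  (* The right-hand side does not depend on the sign of N. *)
  flow_equation : forall c d t u N, J t -> rep_dom c d (F t) u ->
    unit_normal (g c t) (rep c d (F t)) u N ->
    (fun s => rep c d (F s) u)^`() t
    = mean_curvature (g c t) (rep c d (F t)) u N *: N }.

(* A smooth choice, on an open set O of (time, coordinates on S), of unit
   normals to the hypersurfaces F(t), with components taken in the chart c. *)
Record local_unit_normal (g : metric_family M) (J : set R) (F : R -> S -> M)
    (c : chart M) (d : chart S) (O : set (R * 'rV[R]_m))
    (e0 : R -> 'rV[R]_m -> 'rV[R]_m.+1) : Prop := LocalUnitNormal {
  normal_open : open O;
  normal_dom : O `<=` flow_dom J F c d;
  normal_smooth : smooth_on O (fun z : R * 'rV[R]_m => e0 z.1 z.2);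
  normal_unit : forall t u, O (t, u) ->
    unit_normal (g c t) (rep c d (F t)) u (e0 t u) }.

End Hypersurfaces.

(* Main.v *)
Require Import Defs.
From HB Require Import structures.
From mathcomp Require Import all_boot all_order all_algebra.
From mathcomp Require Import all_classical all_reals all_analysis.
From mathcomp Require Import ring lra.
Import Order.TTheory GRing.Theory Num.Theory.
Import numFieldNormedType.Exports.
Set Implicit Arguments.
Unset Strict Implicit.
Unset Printing Implicit Defensive.
Local Open Scope ring_scope.
Local Open Scope classical_set_scope.

(** The identity is local, so everything happens in one chart c of the ambient
    manifold and one chart d of the hypersurface.  Write H for the mean
    curvature, T for the tangential gradient of f, J for the tangent frame and E
    for the unit normal; thus grad f = T + (E f) E.

    The soliton condition gives H = - df(E).  Hence H never has to be computed
    from second derivatives of the immersion: its derivatives are first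
    derivatives of df and of E.  The normal satisfies g(E, E) = 1 and
    g(E, J_i) = 0, and differentiating these two relations gives the components
    of each covariant derivative of E.
    - In the direction of J_i, with Hess f = - Ric, this yields
      dH(J_i) = Ric(E, J_i) + A(T, J_i)  ([d_soliton_curvatureE]).
    - In time, the metric contributes - 2 Ric, the differential of f evolves by
      the differential of |grad f|^2, and the frame by d_i (H E); the Ricci
      terms cancel and dH/dt = <T, dH>  ([soliton_curvature_dt]).
    What remains of the claimed expression is Ric(E, grad f) - (1/2) E(R), and
    this vanishes by the identity dR = 2 Ric(grad f) of steady solitons
    ([soliton_identity]).  That identity compares the contracted second Bianchi
    identity with the trace of the Ricci identity for grad f.

    All this is algebra with derivations.  It is therefore carried out over
    arbitrary commutative rings K and L with commuting derivations, K standing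
    for the functions of (time, ambient coordinates), L for those of (time,
    coordinates on the hypersurface), related by a ring morphism K -> L that
    obeys the chain rule ([hypersurface_evolution]).  Tensors become matrices
    over these rings, and most tensor identities become identities between
    products of matrices.

    To apply the algebra, the smooth functions on an open set are made into a
    commutative ring ([sfun]) on which directional derivatives are commuting
    derivations; this rests on the closure properties of C^k functions and on
    the symmetry of second derivatives ([schwarz]).  Evaluation at a point is a
    ring morphism to the real numbers and turns the algebraic objects back into
    the Christoffel symbols, curvatures and gradients of the chart. *)

(** * Derivations and matrices *)

Definition derivation (K : comPzRingType) (D : K -> K) : Prop :=
  {morph D : a b / a + b} /\ forall a b, D (a * b) = D a * b + a * D b.

Section Derivation.
Variables (K : comPzRingType) (D : K -> K).
Hypothesis hD : derivation D.

Lemma derD a b : D (a + b) = D a + D b. Proof. exact: hD.1. Qed.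

Lemma derM a b : D (a * b) = D a * b + a * D b. Proof. exact: hD.2. Qed.

Lemma der0 : D 0 = 0.
Proof. by apply: (@addrI _ (D 0)); rewrite -derD !addr0. Qed.

Lemma derN a : D (- a) = - D a.
Proof. by apply: (@addrI _ (D a)); rewrite -derD !subrr der0. Qed.

Lemma der_sum (I : Type) (r : seq I) (P : pred I) (F : I -> K) :
  D (\sum_(i <- r | P i) F i) = \sum_(i <- r | P i) D (F i).
Proof. exact: (big_morph D derD der0). Qed.

Lemma der1 : D 1 = 0.
Proof. by apply: (@addrI _ (D 1)); rewrite addr0 -{3}[1]mulr1 derM mulr1 mul1r. Qed.

Lemma der_mxD m n (A B : 'M[K]_(m, n)) :
  map_mx D (A + B) = map_mx D A + map_mx D B.
Proof. by apply/matrixP => i j; rewrite !mxE derD. Qed.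

Lemma der_mxN m n (A : 'M[K]_(m, n)) : map_mx D (- A) = - map_mx D A.
Proof. by apply/matrixP => i j; rewrite !mxE derN. Qed.

Lemma der_mxM m n p (A : 'M[K]_(m, n)) (B : 'M[K]_(n, p)) :
  map_mx D (A *m B) = map_mx D A *m B + A *m map_mx D B.
Proof.
apply/matrixP => i j; rewrite !mxE der_sum -big_split /=.
by apply: eq_bigr => k _; rewrite !mxE derM.
Qed.

Lemma der_mx1 n : map_mx D (1%:M : 'M[K]_n) = 0.
Proof. by apply/matrixP => i j; rewrite !mxE; case: eqP; rewrite ?der1 ?der0. Qed.

End Derivation.

Lemma addmxE (K : pzRingType) m n (A B : 'M[K]_(m, n)) i j :
  (A + B) i j = A i j + B i j.
Proof. by rewrite mxE. Qed.

Lemma oppmxE (K : pzRingType) m n (A : 'M[K]_(m, n)) i j :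
  (- A) i j = - A i j.
Proof. by rewrite mxE. Qed.

Lemma zeromxE (K : pzRingType) m n i j : (0 : 'M[K]_(m, n)) i j = 0.
Proof. by rewrite mxE. Qed.

Lemma trmxD (K : pzRingType) m n (A B : 'M[K]_(m, n)) : (A + B)^T = A^T + B^T.
Proof. by apply/matrixP => i j; rewrite !mxE. Qed.

Lemma trmxN (K : pzRingType) m n (A : 'M[K]_(m, n)) : (- A)^T = - A^T.
Proof. by apply/matrixP => i j; rewrite !mxE. Qed.

Lemma rv_dotC (K : comPzRingType) n (v w : 'rV[K]_n) : v *m w^T = w *m v^T.
Proof.
apply/matrixP => i j; rewrite !mxE !ord1.
by apply: eq_bigr => k _; rewrite !mxE mulrC.
Qed.

Lemma double_inj (K : comPzRingType) (half a b : K) :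
  half + half = 1 -> a + a = b + b -> a = b.
Proof.
by move=> half2 h; rewrite -[a]mul1r -[b]mul1r -half2 !mulrDl -!mulrDr h.
Qed.

Lemma double_mx_inj (K : comPzRingType) (half : K) p q (A B : 'M[K]_(p, q)) :
  half + half = 1 -> A + A = B + B -> A = B.
Proof.
move=> half2 h; apply/matrixP => i j; apply: (double_inj half2).
by rewrite -!addmxE h.
Qed.

(** Matrix identities over a commutative ring that only use the ring axioms of
    noncommutative algebra.  Once products are expanded and entries are taken,
    [ring] sees each entry of a product as an atom, so that the commutativity
    of the base ring cannot exchange the factors. *)
Ltac mxring :=
  rewrite ?(mulmxDl, mulmxDr, mulNmx, mulmxN, mulmxA);
  apply/matrixP => ? ?; rewrite ?(addmxE, oppmxE, zeromxE); ring.

Lemma left_inverse_invmx (R : comUnitRingType) n (A B : 'M[R]_n) :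
  A *m B = 1%:M -> A = invmx B.
Proof.
move=> AB; have [_ uB] := mulmx1_unit AB.
by rewrite -[LHS]mulmx1 -(mulmxV uB) mulmxA AB mul1mx.
Qed.

(** The rows E and J form a basis whose Gram matrix is block-diagonal, with
    blocks 1 and the induced metric; this makes the coordinates of [v] explicit.
    One-sided inverses of square matrices over a commutative ring are two-sided,
    so the argument also applies over rings of functions. *)
Lemma tangent_normal_split (L : comPzRingType) m (G : 'M[L]_(1 + m)) (hi : 'M[L]_m)
    (J : 'M[L]_(m, 1 + m)) (E v : 'rV[L]_(1 + m)) :
  E *m G *m E^T = 1%:M -> E *m G *m J^T = 0 -> G^T = G ->
  hi *m (J *m G *m J^T) = 1%:M ->
  v = (v *m G *m J^T *m hi) *m J + (v *m G *m E^T) *m E.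
Proof.
move=> EE EJ Gs inverse_induced; pose B : 'M[L]_(1 + m) := col_mx E J.
have JE : J *m G *m E^T = 0.
  by apply: trmx_inj; rewrite trmx0 !trmx_mul trmxK Gs mulmxA.
have BB : B *m (G *m B^T *m block_mx 1%:M 0 0 hi) = 1%:M.
  rewrite !mulmxA /B mul_col_mx tr_col_mx mul_col_row EE EJ JE.
  by rewrite mulmx_block !(mulmx0, mul0mx, mulmx1, addr0, add0r) (mulmx1C inverse_induced)
    -scalar_mx_block.
rewrite -[LHS]mulmx1 -(mulmx1C BB) !mulmxA /B tr_col_mx mul_mx_row mul_row_block.
by rewrite !(mulmx0, mulmx1, addr0, add0r) mul_row_col addrC.
Qed.

(** * Levi-Civita connection and Bianchi identities *)

Section LeviCivita.
Variables (K : comPzRingType) (n : nat) (d : 'I_n -> K -> K).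
Hypothesis dD : forall i, derivation (d i).
Hypothesis dC : forall i j a, d i (d j a) = d j (d i a).
Variable half : K.
Hypothesis half2 : half + half = 1.
Variables g gi : 'M[K]_n.
Hypothesis g_sym : g^T = g.
Hypothesis inverse_metric : gi *m g = 1%:M.

Local Notation "''d_' i A" := (map_mx (d i) A) (at level 9, i at level 0, A at level 9).

Definition gamma (k i j : 'I_n) : K :=
  half * \sum_l gi k l * (d i (g j l) + d j (g i l) - d l (g i j)).

(** Vector fields are rows and covectors are treated as rows too: the covariant
    derivative of a vector field v is [d i v + v *m connection i], that of a
    covector w is [d i w - w *m (connection i)^T]. *)
Definition connection (i : 'I_n) : 'M[K]_n := \matrix_(j, k) gamma k i j.

(** The entry (k, l) is dx^l (Rm(d_i, d_j) d_k); products come in reverse order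
    because the matrices act on rows. *)
Definition curvature (i j : 'I_n) : 'M[K]_n :=
  'd_i (connection j) - 'd_j (connection i)
  + connection j *m connection i - connection i *m connection j.

Definition ricci_mx : 'M[K]_n := \matrix_(j, k) \sum_i curvature i j k i.

Definition scalar_curv : K := \sum_i \sum_j gi i j * ricci_mx i j.

Lemma mul_metric_inverse : g *m gi = 1%:M. Proof. exact: mulmx1C. Qed.

Lemma inverse_metric_sym : gi^T = gi.
Proof.
have h : g *m gi^T = 1%:M by rewrite -{1}g_sym -trmx_mul inverse_metric trmx1.
by rewrite -[gi^T]mul1mx -inverse_metric -mulmxA h mulmx1.
Qed.

Lemma metricC i j : g i j = g j i. Proof. by rewrite -{1}g_sym mxE. Qed.

Lemma connection_sym i j k : connection i j k = connection j i k.
Proof.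
rewrite !mxE /gamma; congr (_ * _); apply: eq_bigr => l _.
by rewrite (metricC i j); congr (_ * (_ - _)); exact: addrC.
Qed.

Lemma connection_lower i : connection i *m g =
  \matrix_(j, p) (half * (d i (g j p) + d j (g i p) - d p (g i j))).
Proof.
set B := \matrix_(j, p) _.
suff -> : connection i = B *m gi by rewrite -mulmxA inverse_metric mulmx1.
apply/matrixP => j k; rewrite !mxE /gamma mulr_sumr; apply: eq_bigr => l _.
by rewrite !mxE -[in gi k l]inverse_metric_sym mxE; ring.
Qed.

(** In the sum of [connection_lower] and its transpose, four of the six
    derivatives of the metric cancel and the other two agree. *)
Lemma metric_compat i : 'd_i g = connection i *m g + g *m (connection i)^T.
Proof.
have -> : g *m (connection i)^T = (connection i *m g)^T by rewrite trmx_mul g_sym.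
rewrite connection_lower; apply/matrixP => j p; rewrite !mxE.
rewrite (metricC p j) (metricC i p) (metricC i j).
rewrite -[LHS]mul1r -half2; ring.
Qed.

Lemma inverse_compat i : 'd_i gi = - (gi *m connection i) - (connection i)^T *m gi.
Proof.
have := congr1 (fun A => map_mx (d i) A *m gi) inverse_metric.
rewrite /= (der_mxM (dD i)) (der_mx1 (dD i)) mul0mx mulmxDl -mulmxA mul_metric_inverse mulmx1.
move/eqP; rewrite addr_eq0 => /eqP ->.
rewrite metric_compat mulmxDr !mulmxDl !mulmxA -[gi *m connection i *m g *m gi]mulmxA.
by rewrite mul_metric_inverse inverse_metric mulmx1 mul1mx opprD.
Qed.

Lemma curvature_gamma i j k l : curvature i j k l =
  d i (gamma l j k) - d j (gamma l i k)
  + \sum_a (gamma l i a * gamma a j k - gamma l j a * gamma a i k).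
Proof.
rewrite /curvature !(addmxE, oppmxE) sumrB addrA ![('d_ _ _) _ _]mxE.
rewrite ![(_ *m _) _ _]mxE /connection !mxE; congr (_ + _ - _); apply: eq_bigr => a _;
  by rewrite !mxE mulrC.
Qed.

Lemma curvature_anti i j : curvature j i = - curvature i j.
Proof. rewrite /curvature; mxring. Qed.

Lemma dCmx p q i j (A : 'M[K]_(p, q)) : 'd_i ('d_j A) = 'd_j ('d_i A).
Proof. by apply/matrixP => a b; rewrite !mxE dC. Qed.

Lemma dtr p q i (A : 'M[K]_(p, q)) : 'd_i (A^T) = ('d_i A)^T.
Proof. by rewrite map_trmx. Qed.

(** Expand d_i d_j g - d_j d_i g = 0 twice with [metric_compat]: the mixed terms
    are symmetric in i and j and drop out. *)
Lemma curvature_skew i j : curvature i j *m g + g *m (curvature i j)^T = 0.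
Proof.
have := dCmx i j g.
rewrite !metric_compat !(der_mxD (dD _)) !(der_mxM (dD _)) !metric_compat !dtr.
move=> /eqP; rewrite -subr_eq0 => /eqP <-.
rewrite /curvature ?(trmxD, trmxN, trmx_mul); mxring.
Qed.

(** Only the two endomorphism indices are differentiated covariantly.  The
    connection terms for the two form indices would cancel in the cyclic sum,
    the connection being torsion-free. *)
Lemma second_bianchi k i j :
  let D k i j := 'd_k (curvature i j)
    + curvature i j *m connection k - connection k *m curvature i j in
  D k i j + D i j k + D j k i = 0.
Proof.
rewrite /= /curvature !(der_mxD (dD _), der_mxN (dD _), der_mxM (dD _)).
rewrite (dCmx k i) (dCmx k j) (dCmx i j); mxring.
Qed.

(** Raising the lower endomorphism index makes the curvature skew as a matrix
    ([curv_up_tr]), which is what the contractions below use. *)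
Definition curv_up i j : 'M[K]_n := gi *m curvature i j.

Lemma curv_up_anti i j p q : curv_up j i p q = - curv_up i j p q.
Proof. by rewrite /curv_up curvature_anti mulmxN mxE. Qed.

Lemma curv_up_tr i j : (curv_up i j)^T = - curv_up i j.
Proof.
rewrite /curv_up; move: (curvature i j) (curvature_skew i j) => C Cskew.
have := congr1 (fun A => gi *m A *m gi) Cskew.
rewrite mulmx0 mul0mx mulmxDr !mulmxDl !mulmxA inverse_metric mul1mx.
rewrite -!mulmxA mul_metric_inverse mulmx1.
by move=> /eqP; rewrite addrC addr_eq0 => /eqP <-; rewrite trmx_mul inverse_metric_sym.
Qed.

Lemma curv_up_skew i j p q : curv_up i j q p = - curv_up i j p q.
Proof. by move/matrixP: (curv_up_tr i j) => /(_ p q); rewrite !mxE. Qed.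

Definition cov_up k i j :=
  'd_k (curv_up i j) + curv_up i j *m connection k + (connection k)^T *m curv_up i j.

Lemma cov_up_anti k i j p q : cov_up k j i p q = - cov_up k i j p q.
Proof.
have e : curv_up j i = - curv_up i j by apply/matrixP => a b; rewrite curv_up_anti oppmxE.
rewrite -oppmxE; congr (fun_of_matrix _ p q).
by rewrite /cov_up e (der_mxN (dD _)); move: (curv_up i j) => A; mxring.
Qed.

Lemma cov_up_skew k i j p q : cov_up k i j q p = - cov_up k i j p q.
Proof.
have <- : (cov_up k i j)^T p q = cov_up k i j q p by rewrite mxE.
rewrite -oppmxE; congr (fun_of_matrix _ p q).
rewrite /cov_up; move: (curv_up i j) (curv_up_tr i j) => A Askew.
by rewrite !trmxD !trmx_mul trmxK -dtr Askew (der_mxN (dD _)); mxring.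
Qed.

Lemma cov_up_bianchi k i j : cov_up k i j + cov_up i j k + cov_up j k i = 0.
Proof.
rewrite -[RHS](mulmx0 _ gi) -(second_bianchi k i j) /=.
rewrite /cov_up /curv_up !(der_mxM (dD _)) !inverse_compat.
move: (curvature k i) (curvature i j) (curvature j k) => C1 C2 C3; mxring.
Qed.

(** The endomorphism - Ric^#.  On a soliton it is the covariant derivative of
    grad f ([cov_grad]). *)
Definition minus_ricci : 'M[K]_n := - (ricci_mx *m gi).

Lemma minus_ricci_up k i : minus_ricci k i = \sum_j curv_up j k j i.
Proof.
rewrite /minus_ricci mxE [(ricci_mx *m gi) k i]mxE -sumrN.
under [RHS]eq_bigr do rewrite curv_up_skew /curv_up mxE.
rewrite [RHS]sumrN [in RHS]exchange_big /= -sumrN; apply: eq_bigr => q _; congr (- _).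
rewrite [ricci_mx k q]mxE -mulr_sumr mulrC -{1}inverse_metric_sym mxE; congr (_ * _).
Qed.

Lemma inverse_metricC i j : gi i j = gi j i. Proof. by rewrite -{1}inverse_metric_sym mxE. Qed.

Lemma tr_minus_ricci : \tr minus_ricci = - scalar_curv.
Proof.
rewrite /minus_ricci linearN /=; congr (- _); apply: eq_bigr => i _.
by rewrite mxE; apply: eq_bigr => j _; rewrite mulrC inverse_metricC.
Qed.

Lemma ricci_up k i : - minus_ricci k i = \sum_j curv_up k j j i.
Proof. by rewrite minus_ricci_up -sumrN; apply: eq_bigr => j _; rewrite curv_up_anti opprK. Qed.

Lemma scalar_curv_up : scalar_curv = \sum_i \sum_j curv_up i j j i.
Proof.
rewrite -[scalar_curv]opprK -tr_minus_ricci -sumrN; apply: eq_bigr => i _; exact: ricci_up.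
Qed.

Lemma cov_up_trace1 k :
  \sum_i \sum_j cov_up k i j j i =
  d k scalar_curv - 2 * \tr (minus_ricci *m connection k).
Proof.
under eq_bigr do under eq_bigr do rewrite /cov_up 2!addmxE.
under eq_bigr do rewrite 2!big_split /=; rewrite 2!big_split /=.
have <- : d k scalar_curv = \sum_i \sum_j ('d_k (curv_up i j)) j i.
  rewrite scalar_curv_up (der_sum (dD k)); apply: eq_bigr => i _.
  by rewrite (der_sum (dD k)); apply: eq_bigr => j _; rewrite [RHS]mxE.
have -> : \sum_i \sum_j (curv_up i j *m connection k) j i = - \tr (minus_ricci *m connection k).
  rewrite -sumrN; apply: eq_bigr => i _; rewrite mxE -sumrN.
  under eq_bigr do rewrite mxE.
  rewrite exchange_big; apply: eq_bigr => a _ /=.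
  by rewrite -mulr_suml -ricci_up mulNr.
have -> : \sum_i \sum_j ((connection k)^T *m curv_up i j) j i = - \tr (minus_ricci *m connection k).
  rewrite exchange_big -sumrN; apply: eq_bigr => j _; rewrite mxE -sumrN /=.
  under eq_bigr do rewrite mxE.
  rewrite exchange_big; apply: eq_bigr => a _ /=.
  under eq_bigr do rewrite mxE curv_up_skew.
  by rewrite -mulr_sumr sumrN -minus_ricci_up mulrN mulrC.
by ring.
Qed.

(** The second connection term contracts an expression symmetric in two indices
    ([connection_sym]) with one that is skew in them ([curv_up_skew]). *)
Lemma cov_up_trace2 k :
  \sum_i \sum_j cov_up i j k j i =
  \sum_i (d i (minus_ricci k i) + (minus_ricci *m connection i) k i).
Proof.
under eq_bigr do under eq_bigr do rewrite /cov_up 2!addmxE.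
under eq_bigr do rewrite 2!big_split /=; rewrite 2!big_split /=.
rewrite [X in _ + X](_ : _ = 0) ?addr0; last first.
  rewrite exchange_big big1 //= => j _; apply: (double_inj half2).
  rewrite addr0; apply/eqP; rewrite addr_eq0; apply/eqP.
  under eq_bigr do rewrite mxE.
  rewrite [in RHS]exchange_big -sumrN; apply: eq_bigr => i _ /=.
  rewrite -sumrN; apply: eq_bigr => a _; rewrite ![_^T _ _]mxE.
  by rewrite connection_sym curv_up_skew mulrN.
rewrite -big_split; apply: eq_bigr => i _ /=; congr (_ + _).
  by rewrite minus_ricci_up (der_sum (dD i)); apply: eq_bigr => j _; rewrite [LHS]mxE.
rewrite mxE; under eq_bigr do rewrite mxE; rewrite exchange_big.
by apply: eq_bigr => a _ /=; rewrite -mulr_suml -minus_ricci_up.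
Qed.

(** The divergence of - Ric^#: the sum is the part that comes from the upper
    index, the trace corrects for the lower one. *)
Definition div_minus_ricci k :=
  \sum_i (d i (minus_ricci k i) + (minus_ricci *m connection i) k i)
  - \tr (minus_ricci *m connection k).

(** Contract both pairs of indices in the cyclic identity.  One term is the
    derivative of the scalar curvature, and the two others are equal by the
    skewness of the curvature in either pair. *)
Lemma contracted_bianchi k : d k scalar_curv = - (2 * div_minus_ricci k).
Proof.
have t3 : \sum_i \sum_j cov_up j k i j i = \sum_i \sum_j cov_up i j k j i.
  rewrite exchange_big; apply: eq_bigr => i _; apply: eq_bigr => j _ /=.
  by rewrite cov_up_anti cov_up_skew opprK.
have : \sum_i \sum_j (cov_up k i j + cov_up i j k + cov_up j k i) j i = 0.
  by rewrite big1 // => i _; rewrite big1 // => j _; rewrite cov_up_bianchi mxE.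
under eq_bigr do under eq_bigr do rewrite 2!addmxE.
under eq_bigr do rewrite 2!big_split /=; rewrite 2!big_split /=.
rewrite t3 cov_up_trace1 cov_up_trace2 /div_minus_ricci => h.
rewrite -[LHS]subr0 -{1}h; ring.
Qed.

(** * Gradient steady solitons *)

Section Potential.
Variable f : K.
Definition differential : 'rV[K]_n := \row_i d i f.
Definition hess_mx : 'M[K]_n :=
  \matrix_(i, j) (d i (d j f) - \sum_k gamma k i j * d k f).
Hypothesis soliton : ricci_mx + hess_mx = 0.

Definition grad := differential *m gi.

Lemma d_differential i :
  'd_i differential = differential *m (connection i)^T - row i ricci_mx.
Proof.
have -> : ricci_mx = - hess_mx by apply/eqP; rewrite -addr_eq0 soliton.
apply/matrixP => r j; rewrite [LHS]mxE [in LHS]mxE addmxE oppmxE 2!mxE /hess_mx mxE.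
rewrite (eq_bigr (fun k => gamma k i j * d k f)); last by move=> k _; rewrite !mxE mulrC.
rewrite [in X in _ - X]mxE; ring.
Qed.

Lemma cov_grad i : 'd_i grad + grad *m connection i = row i minus_ricci.
Proof.
rewrite /grad (der_mxM (dD i)) d_differential inverse_compat /minus_ricci linearN /= row_mul.
mxring.
Qed.

(** Commuting two covariant derivatives of grad f, whose first covariant
    derivative is - Ric^#. *)
Lemma ricci_identity i j :
  'd_i (row j minus_ricci) + row j minus_ricci *m connection i
  - ('d_j (row i minus_ricci) + row i minus_ricci *m connection j)
  = grad *m curvature i j.
Proof.
rewrite -!cov_grad; move: grad => v.
rewrite !(der_mxD (dD _)) !(der_mxM (dD _)) (dCmx i j) /curvature; mxring.
Qed.

(** The trace of [ricci_identity] reads div (- Ric^#) + dR = Ric(grad f), and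
    [contracted_bianchi] says that div (- Ric^#) = - dR / 2. *)
Lemma soliton_identity k : d k scalar_curv = 2 * (grad *m ricci_mx^T) 0 k.
Proof.
have h : div_minus_ricci k + d k scalar_curv = (grad *m ricci_mx^T) 0 k.
  transitivity (\sum_i (grad *m curvature i k) 0 i); last first.
    under eq_bigr do rewrite mxE; rewrite exchange_big mxE.
    by apply: eq_bigr => p _ /=; rewrite -mulr_sumr !mxE.
  rewrite -[d k scalar_curv]opprK -(derN (dD k)) -tr_minus_ricci (der_sum (dD k)) /div_minus_ricci.
  rewrite -addrA -opprD -big_split -sumrB /=; apply: eq_bigr => i _.
  rewrite -ricci_identity -!row_mul; move: (minus_ricci) => w.
  by rewrite 2!addmxE oppmxE addmxE !map_row ![row _ _ _ _]mxE ![('d_ _ w) _ _]mxE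
    [X in _ - X]addrC.
rewrite -h mulrDr -[X in X + _]opprK -contracted_bianchi; ring.
Qed.

Section Flow.
Variable dt : K -> K.
Hypothesis dtC : forall i a, dt (d i a) = d i (dt a).
Hypothesis flow_g : map_mx dt g = - (ricci_mx + ricci_mx).
Hypothesis flow_f : dt f = (grad *m differential^T) 0 0.

(** The Ricci tensor is symmetric since it is, up to a factor, the time
    derivative of the metric. *)
Lemma ricci_mx_sym : ricci_mx^T = ricci_mx.
Proof.
apply: (double_mx_inj half2); apply: oppr_inj.
by rewrite -flow_g -[in RHS]g_sym -map_trmx flow_g trmxN trmxD.
Qed.

(** d/dt df = d |grad f|^2 = 2 Hess f(grad f) = - 2 Ric(grad f). *)
Lemma dt_differential :
  map_mx dt differential = - (grad *m ricci_mx + grad *m ricci_mx).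
Proof.
apply/matrixP => r i; rewrite [LHS]mxE mxE dtC flow_f.
transitivity ('d_i (grad *m differential^T) 0 0); first by rewrite [RHS]mxE.
have -> : 'd_i (grad *m differential^T) =
    - (grad *m (row i ricci_mx)^T) - (grad *m (row i ricci_mx)^T).
  rewrite [X in _ = _ - X]rv_dotC.
  have vt : grad^T = gi *m differential^T by rewrite /grad trmx_mul inverse_metric_sym.
  rewrite (der_mxM (dD i)) dtr d_differential vt /grad (der_mxM (dD i)) d_differential.
  rewrite inverse_compat trmxD trmxN trmx_mul trmxK.
  by mxring.
have -> : grad *m (row i ricci_mx)^T = col i (grad *m ricci_mx).
  by rewrite tr_row ricci_mx_sym !colE mulmxA.
by rewrite [r]ord1 -opprD !oppmxE !addmxE ![col _ _ _ _]mxE.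
Qed.

(** * Evolution of the mean curvature, algebraically *)

Section Hypersurface.
Variables (L : comPzRingType) (m : nat) (psi : {rmorphism K -> L}).
Local Notation pb := (map_mx psi).

(** The connection form applied to a velocity w, pulled back by [psi]. *)
Definition connection_along (w : 'rV[L]_n) : 'M[L]_n :=
  \sum_a w 0 a *: pb (connection a).

Lemma torsion_free v w : v *m connection_along w = w *m connection_along v.
Proof.
apply/matrixP => i k; rewrite [i]ord1 !mulmx_sumr !summxE.
under eq_bigr => a _ do rewrite -scalemxAr mxE [X in _ * X]mxE mulr_sumr.
rewrite exchange_big; apply: eq_bigr => a _ /=.
rewrite -scalemxAr mxE [X in _ * X]mxE mulr_sumr; apply: eq_bigr => b _.
by rewrite ![pb _ _ _]mxE connection_sym; ring.
Qed.

Lemma mul_connection_along (v w : 'rV[L]_n) k :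
  (v *m connection_along w) 0 k = \sum_a \sum_b psi (gamma k a b) * w 0 a * v 0 b.
Proof.
rewrite mulmx_sumr summxE; apply: eq_bigr => a _.
rewrite -scalemxAr mxE [X in _ * X]mxE mulr_sumr; apply: eq_bigr => b _.
by rewrite [pb _ _ _]mxE [connection _ _ _]mxE; ring.
Qed.

Lemma connection_along_mull (w : 'rV[L]_n) p (A : 'M[L]_(n, p)) :
  connection_along w *m A = \sum_a w 0 a *: (pb (connection a) *m A).
Proof. by rewrite mulmx_suml; apply: eq_bigr => a _; rewrite scalemxAl. Qed.

Lemma connection_along_mulr (w : 'rV[L]_n) p (A : 'M[L]_(p, n)) :
  A *m (connection_along w)^T = \sum_a w 0 a *: (A *m (pb (connection a))^T).
Proof.
rewrite linear_sum mulmx_sumr; apply: eq_bigr => a _.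
by rewrite linearZ /= scalemxAr.
Qed.

(** Here D is any of the derivations of L and w is the velocity of the moving
    point in the direction of D.  The number eps is 1 when D is the time
    derivative, which also sees the dependence of the metric and of f on time,
    and 0 when D is a derivative along the hypersurface. *)
Section Along.
Variables (D : L -> L) (eps : L) (w : 'rV[L]_n).
Hypothesis DD : derivation D.
Hypothesis chain : forall a, D (psi a) =
  eps * psi (dt a) + \sum_k w 0 k * psi (d k a).

Local Notation G := (pb g).
Local Notation r := (eps *: pb ricci_mx).

Definition cov_along p (X : 'M[L]_(p, n)) := map_mx D X + X *m connection_along w.

Lemma chain_mx p q (A : 'M[K]_(p, q)) : map_mx D (pb A) =
  eps *: pb (map_mx dt A) + \sum_k w 0 k *: pb ('d_k A).
Proof.
apply/matrixP => i j; rewrite [LHS]mxE [in LHS]mxE chain !mxE summxE.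
by congr (_ + _); apply: eq_bigr => k _; rewrite !mxE.
Qed.

Lemma D_metric : map_mx D G =
  - (r + r) + (connection_along w *m G + G *m (connection_along w)^T).
Proof.
rewrite chain_mx flow_g connection_along_mull connection_along_mulr -big_split /=; congr (_ + _).
  by rewrite map_mxN map_mxD scalerN scalerDr.
apply: eq_bigr => a _; rewrite metric_compat map_mxD !map_mxM -map_trmx.
by rewrite scalerDr.
Qed.

Lemma D_differential : map_mx D (pb differential) =
  - (pb grad *m r + pb grad *m r)
  + pb differential *m (connection_along w)^T - w *m pb ricci_mx.
Proof.
rewrite chain_mx dt_differential connection_along_mulr -addrA; congr (_ + _).
  by rewrite map_mxN map_mxD !map_mxM scalerN scalerDr -!scalemxAr.
rewrite mulmx_sum_row -sumrB; apply: eq_bigr => a _.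
by rewrite d_differential map_mxD map_mxN map_mxM -map_trmx scalerBr map_row.
Qed.

Lemma D_inner p q (X : 'M[L]_(p, n)) (Y : 'M[L]_(q, n)) :
  map_mx D (X *m G *m Y^T) = cov_along X *m G *m Y^T + X *m G *m (cov_along Y)^T
    - (X *m r *m Y^T + X *m r *m Y^T).
Proof.
rewrite !(der_mxM DD) D_metric /cov_along trmxD trmx_mul map_trmx.
move: r => r'; mxring.
Qed.

Lemma D_pairing p (X : 'M[L]_(p, n)) :
  map_mx D (pb differential *m X^T) =
    pb differential *m (cov_along X)^T - w *m pb ricci_mx *m X^T
    - (pb grad *m r *m X^T + pb grad *m r *m X^T).
Proof.
rewrite !(der_mxM DD) D_differential /cov_along trmxD trmx_mul map_trmx.
move: r (pb grad) (pb differential) => r' v q; mxring.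
Qed.

End Along.

Section Evolution.
Variables (e : 'I_m -> L -> L) (et : L -> L).
Hypothesis eD : forall i, derivation (e i).
Hypothesis etD : derivation et.
Hypothesis eC : forall i a, et (e i a) = e i (et a).
Variable y : 'rV[L]_n.
Definition jac_mx : 'M[L]_(m, n) := \matrix_(i, a) e i (y 0 a).
Hypothesis chain_e : forall i a, e i (psi a) = \sum_k jac_mx i k * psi (d k a).
Hypothesis chain_t : forall a,
  et (psi a) = psi (dt a) + \sum_k et (y 0 k) * psi (d k a).
Variable E : 'rV[L]_n.
Local Notation G := (pb g).
Local Notation J := jac_mx.
Hypothesis E_unit : E *m G *m E^T = 1%:M.
Hypothesis E_normal : E *m G *m J^T = 0.
(** This is - df(E), the value that the soliton condition imposes on the mean
    curvature.  As a 1 x 1 matrix it can be multiplied with the others. *)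
Definition soliton_curvature : 'M[L]_1 := - (pb differential *m E^T).
Local Notation H := soliton_curvature.
Hypothesis flow_y : map_mx et y = H *m E.
Variable T : 'rV[L]_m.
Hypothesis split_grad : pb grad = T *m J - H *m E.

Local Notation cove i := (cov_along (e i) (row i J)).
Local Notation covt := (cov_along et (map_mx et y)).

Definition second_ff : 'M[L]_m :=
  \matrix_(i, j) (E *m G *m (cove i (row j J))^T) 0 0.
Local Notation A := second_ff.

Definition d_soliton_curvature : 'rV[L]_m := \row_i e i (H 0 0).

Let chain_e' i a : e i (psi a) =
  0 * psi (dt a) + \sum_k row i J 0 k * psi (d k a).
Proof.
by rewrite mul0r add0r chain_e; apply: eq_bigr => k _; rewrite [in RHS]mxE.
Qed.

Let chain_t' a : et (psi a) =
  1 * psi (dt a) + \sum_k map_mx et y 0 k * psi (d k a).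
Proof.
by rewrite mul1r chain_t; congr (_ + _); apply: eq_bigr => k _; rewrite [in RHS]mxE.
Qed.

Lemma G_sym : G^T = G. Proof. by rewrite map_trmx g_sym. Qed.

Let half2L : psi half + psi half = 1.
Proof. by rewrite -rmorphD half2 rmorph1. Qed.

Lemma innerC (v w : 'rV[L]_n) : v *m G *m w^T = w *m G *m v^T.
Proof. by rewrite rv_dotC trmx_mul G_sym mulmxA. Qed.

Lemma row_second_ff i : row i A = E *m G *m (cove i J)^T.
Proof.
have rowE j : cove i (row j J) = row j (cove i J).
  by apply/matrixP => a k; rewrite /cov_along -row_mul !(mxE, addmxE).
apply/matrixP => a j; rewrite [a]ord1 mxE [LHS]mxE rowE !mxE.
by apply: eq_bigr => k _; rewrite !mxE.
Qed.

Lemma cove_normal_normal i : cove i E *m G *m E^T = 0.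
Proof.
have := congr1 (map_mx (e i)) E_unit.
rewrite (D_inner (eD i) (chain_e' i)) der_mx1 // scale0r mulmx0 mul0mx addr0 subr0.
by rewrite (innerC E) => h; apply: (double_mx_inj half2L); rewrite h addr0.
Qed.

Lemma cove_normal_tangent i : cove i E *m G *m J^T = - row i A.
Proof.
have := congr1 (map_mx (e i)) E_normal.
rewrite (D_inner (eD i) (chain_e' i)) scale0r mulmx0 mul0mx addr0 subr0 -row_second_ff.
have -> : map_mx (e i) (0 : 'M[L]_(1, m)) = 0.
  by apply/matrixP => a b; rewrite !mxE der0.
by move=> /eqP; rewrite addr_eq0 => /eqP.
Qed.

Lemma covt_normal_normal : covt E *m G *m E^T = E *m pb ricci_mx *m E^T.
Proof.
have := congr1 (map_mx et) E_unit.
rewrite (D_inner etD chain_t') der_mx1 // scale1r (innerC E) => /eqP.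
by rewrite subr_eq0 => /eqP /(double_mx_inj half2L).
Qed.

(** Since the connection is torsion-free, the covariant time derivative of the
    frame vector J_i is the covariant derivative along J_i of the velocity H E,
    and its normal component is dH(J_i) because E has constant length. *)
Lemma covt_tangent_normal : E *m G *m (covt J)^T = d_soliton_curvature.
Proof.
have rowE i : row i (covt J) = d_soliton_curvature 0 i *: E + H *m cove i E.
  have -> : row i (covt J) = map_mx et (row i J) + row i J *m connection_along (map_mx et y).
    by apply/matrixP => a k; rewrite /cov_along -row_mul !(mxE, addmxE).
  rewrite (torsion_free _ (map_mx et y)) /cov_along.
  have -> : map_mx et (row i J) = map_mx (e i) (map_mx et y).
    by apply/matrixP => a b; rewrite !mxE ord1 eC.
  rewrite flow_y (der_mxM (eD i)) mulmxDr -mulmxA addrA; congr (_ + _ + _).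
  by apply/matrixP => a b; rewrite !ord1 [LHS]mxE big_ord1 !mxE.
apply/matrixP => a i; rewrite [a]ord1.
transitivity ((E *m G *m (row i (covt J))^T) 0 0).
  by rewrite !mxE; apply: eq_bigr => k _; rewrite !mxE.
rewrite rowE trmxD linearZ /= trmx_mul mulmxDr -scalemxAr E_unit mulmxA.
rewrite (innerC E) cove_normal_normal mul0mx addr0 !mxE mulr1 //.
Qed.

Lemma covt_normal_tangent : covt E *m G *m J^T =
  E *m pb ricci_mx *m J^T + E *m pb ricci_mx *m J^T - d_soliton_curvature.
Proof.
have := congr1 (map_mx et) E_normal.
rewrite (D_inner etD chain_t') scale1r covt_tangent_normal.
have -> : map_mx et (0 : 'M[L]_(1, m)) = 0 by apply/matrixP => a b; rewrite !mxE der0.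
by move=> /eqP; rewrite subr_eq0 => /eqP <-; rewrite addrK.
Qed.

Lemma pullback_differential : pb differential = pb grad *m G.
Proof. by rewrite -map_mxM /grad -mulmxA inverse_metric mulmx1. Qed.

Lemma pullback_ricci_mx_sym : (pb ricci_mx)^T = pb ricci_mx.
Proof. by rewrite map_trmx ricci_mx_sym. Qed.

(** H = - df(E), so dH(J_i) = - (Hess f)(J_i, E) - df(D_i E).  The first term is
    Ric(J_i, E); in the second, D_i E is tangential, so that only the tangential
    part of grad f matters. *)
Lemma d_soliton_curvatureE : d_soliton_curvature = E *m pb ricci_mx *m J^T + T *m A^T.
Proof.
apply/matrixP => a i; rewrite [a]ord1.
have -> : d_soliton_curvature 0 i = (map_mx (e i) H) 0 0 by rewrite !mxE.
rewrite /soliton_curvature (der_mxN (eD i)) (D_pairing (eD i) (chain_e' i)) scale0r mulmx0 mul0mx.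
rewrite addr0 subr0 pullback_differential split_grad !mulmxBl.
have -> : H *m E *m G *m (cove i E)^T = 0.
  by rewrite -!mulmxA (mulmxA E) innerC cove_normal_normal mulmx0.
rewrite subr0 -!mulmxA.
have -> : J *m (G *m (cove i E)^T) = (cove i E *m G *m J^T)^T.
  by rewrite !trmx_mul G_sym trmxK.
rewrite cove_normal_tangent trmxN mulmxN opprB opprK !addmxE; congr (_ + _).
  rewrite (mulmxA (row i J)) rv_dotC trmx_mul pullback_ricci_mx_sym mulmxA.
  by rewrite mulmxA !mxE; apply: eq_bigr => k _; rewrite !mxE.
by rewrite tr_row [LHS]mxE [RHS]mxE; apply: eq_bigr => k _; rewrite ![col _ _ _ _]mxE.
Qed.

(** Differentiate H = - df(E) in time.  Split grad f = T - H E and insert the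
    components of D_t E given by [covt_normal_normal] and
    [covt_normal_tangent]; all Ricci terms cancel. *)
Lemma soliton_curvature_dt : map_mx et H = d_soliton_curvature *m T^T.
Proof.
rewrite /soliton_curvature (der_mxN etD) (D_pairing etD chain_t') scale1r.
have -> : pb differential *m (covt E)^T = T *m (J *m G *m (covt E)^T) - H *m (covt E *m G *m E^T).
  by rewrite pullback_differential split_grad !mulmxBl -!mulmxA (mulmxA E) (innerC E) !mulmxA.
have -> : J *m G *m (covt E)^T = (covt E *m G *m J^T)^T.
  by rewrite !trmx_mul G_sym trmxK mulmxA.
rewrite covt_normal_tangent covt_normal_normal flow_y split_grad (rv_dotC d_soliton_curvature).
rewrite !(trmxD, trmxN) !trmx_mul trmxK pullback_ricci_mx_sym; mxring.
Qed.

Lemma hypersurface_evolution :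
  map_mx et H - (d_soliton_curvature *m T^T + d_soliton_curvature *m T^T) + T *m A *m T^T
  + (E *m pb ricci_mx *m (T *m J)^T + E *m pb ricci_mx *m (T *m J)^T)
  - psi half *: (E *m (\row_k psi (d k scalar_curv))^T)
  - H *m (E *m pb ricci_mx *m E^T) = 0.
Proof.
have -> : psi half *: (E *m (\row_k psi (d k scalar_curv))^T)
   = E *m pb ricci_mx *m (T *m J)^T - H *m (E *m pb ricci_mx *m E^T).
  have -> : \row_k psi (d k scalar_curv) = psi 2 *: (pb grad *m pb ricci_mx).
    apply/matrixP => a k; rewrite ord1 -map_mxM [LHS]mxE soliton_identity.
    by rewrite rmorphM ricci_mx_sym [RHS]mxE; congr (_ * _); rewrite [RHS]mxE.
  rewrite linearZ /= -scalemxAr scalerA -rmorphM mulr_natr mulr2n half2 rmorph1 scale1r.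
  rewrite trmx_mul pullback_ricci_mx_sym split_grad mulmxA trmxD trmxN mulmxDr mulmxN.
  by congr (_ - _); rewrite [LHS]rv_dotC trmx_mul pullback_ricci_mx_sym !mulmxA.
rewrite soliton_curvature_dt.
have Te : d_soliton_curvature *m T^T = E *m pb ricci_mx *m (T *m J)^T + T *m A *m T^T.
  rewrite {1}d_soliton_curvatureE mulmxDl trmx_mul -!mulmxA; congr (_ + _).
  by rewrite -trmx_mul rv_dotC mulmxA.
rewrite Te; mxring.
Qed.

End Evolution.
End Hypersurface.
End Flow.
End Potential.
End LeviCivita.

(** * Functions of class C^k *)

Section Germs.
Variables (R : realType) (V W : normedModType R).

(** Such a function is o(h) around x, so it is differentiable there with
    differential 0.  This makes differentiability a property of germs. *)
Lemma near_eq0_differentiable (e : V -> W) x :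
  (\forall y \near x, e y = 0) -> differentiable e x.
Proof.
move=> e0.
have e0x : e x = 0 by exact: nbhs_singleton e0.
have h : e \o shift x = cst (e x) + (0 : V -> W) +o_ (0 : V) id.
  apply/eqaddoP => eps eps0; rewrite e0x.
  move: e0; rewrite (near_shift 0 x) subr0 => e0; near=> h.
  have -> : (e \o shift x - (cst 0 + (0 : V -> W))) h = e (h + x) - (0 + 0) by [].
  rewrite !addr0 (_ : e (h + x) = 0) ?subrr ?normr0 ?mulr_ge0 ?(ltW eps0) //.
  by near: h.
apply/diff_locallyP.
have c0 : continuous (0 : V -> W) by move=> z; exact: cst_continuous.
by rewrite (diff_unique (df := (\0 : {linear V -> W})) c0 h).
Unshelve. all: by end_near. Qed.

Lemma near_eq_differentiable (f g : V -> W) x :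
  (\forall y \near x, f y = g y) -> differentiable f x -> differentiable g x.
Proof.
move=> fg df; have -> : g = f + (g - f) by rewrite addrC subrK.
apply: differentiableD => //; apply: near_eq0_differentiable.
by apply: filterS fg => y e; rewrite /= -[LHS]/(g y - f y) e subrr.
Qed.

End Germs.

Section Ck.
Variables (R : realType) (V W : normedModType R) (U : set V).
Hypothesis oU : open U.

Lemma near_open x : U x -> \forall y \near x, U y.
Proof. by move=> Ux; apply: open_nbhs_nbhs. Qed.

Lemma eq_on_near (f g : V -> W) x : (forall y, U y -> f y = g y) -> U x ->
  \forall y \near x, f y = g y.
Proof. by move=> fg /near_open; apply: filterS. Qed.

Lemma eq_on_derive (f g : V -> W) v x : (forall y, U y -> f y = g y) -> U x ->
  'D_v f x = 'D_v g x.
Proof. by move=> fg Ux; apply: near_eq_derive; exact: eq_on_near. Qed.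

Lemma Ck_ext k (f g : V -> W) : (forall y, U y -> f y = g y) ->
  Ck k U f -> Ck k U g.
Proof.
elim: k f g => [|k IH] f g fg /=.
  move=> cf x Ux; rewrite /prop_for /continuous_at -(fg _ Ux).
  by apply: cvg_trans (cf x Ux); apply: near_eq_cvg; exact: eq_on_near.
case=> df Df; split=> [x Ux|v].
  exact: near_eq_differentiable (eq_on_near fg Ux) (df x Ux).
by apply: IH (Df v) => y Uy; exact: eq_on_derive.
Qed.

Lemma CkW k (f : V -> W) : Ck k.+1 U f -> Ck k U f.
Proof.
elim: k f => [|k IH] f /=.
  by case=> df _ x Ux; apply: differentiable_continuous; exact: df.
by case=> df Df; split=> // v; apply: IH; exact: Df.
Qed.

Lemma Ck_cst k (a : W) : Ck k U (fun _ => a).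
Proof.
elim: k a => [|k IH] a /=; first by move=> x _; exact: cst_continuous.
split=> [x _|v]; first exact: differentiable_cst.
suff -> : (fun x => 'D_v (fun _ : V => a) x) = (fun _ => 0) by exact: IH.
by apply/funext => x; rewrite derive_cst.
Qed.

Lemma Ck_add k (f g : V -> W) : Ck k U f -> Ck k U g ->
  Ck k U (fun x => f x + g x).
Proof.
elim: k f g => [|k IH] f g /=.
  by move=> cf cg x Ux; apply: (@continuousD _ _ _ f g); [exact: cf|exact: cg].
case=> df Df [dg Dg]; split=> [x Ux|v].
  by apply: (@differentiableD _ _ _ f g); [exact: df|exact: dg].
apply: Ck_ext (IH _ _ (Df v) (Dg v)) => y Uy.
by rewrite [RHS](@deriveD _ _ _ f g) //; apply: diff_derivable;
  [exact: df|exact: dg].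
Qed.

Lemma Ck_opp k (f : V -> W) : Ck k U f -> Ck k U (fun x => - f x).
Proof.
elim: k f => [|k IH] f /=.
  by move=> cf x Ux; apply: (@continuousN _ _ _ f); exact: cf.
case=> df Df; split=> [x Ux|v].
  by apply: (@differentiableN _ _ _ f); exact: df.
apply: Ck_ext (IH _ (Df v)) => y Uy.
by rewrite [RHS](@deriveN _ _ _ f) //; apply: diff_derivable; exact: df.
Qed.

End Ck.

Section CkReal.
Variables (R : realType) (V : normedModType R) (U : set V).
Hypothesis oU : open U.
Implicit Types f g : V -> R.

Lemma Ck_mul k f g : Ck k U f -> Ck k U g -> Ck k U (fun x => f x * g x).
Proof.
elim: k f g => [|k IH] f g.
  by move=> cf cg x Ux; apply: (@continuousM _ _ f g); [exact: cf|exact: cg].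
move=> hf hg; have [df Df] := hf; have [dg Dg] := hg; split=> [x Ux|v].
  by apply: (@differentiableM _ _ f g); [exact: df|exact: dg].
apply: Ck_ext (Ck_add oU (IH _ _ (CkW hf) (Dg v)) (IH _ _ (CkW hg) (Df v))) => //.
move=> y Uy; rewrite [RHS](@deriveM _ _ f g) //; apply: diff_derivable;
  [exact: df|exact: dg].
Qed.

Lemma Ck_inv k f : (forall x, U x -> f x != 0) -> Ck k U f ->
  Ck k U (fun x => (f x)^-1).
Proof.
move=> f0; elim: k => [|k IH].
  by move=> cf x Ux; apply: (@continuousV _ _ f); [exact: f0|exact: cf].
move=> hf; have [df Df] := hf; split=> [x Ux|v].
  by apply: (@differentiableV _ _ f); [exact: df|exact: f0].
have hi := IH (CkW hf).
apply: Ck_ext (Ck_opp oU (Ck_mul (Ck_mul hi hi) (Df v))) => // y Uy.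
rewrite [RHS](@deriveV _ _ f); [|exact: f0|by apply: diff_derivable; exact: df].
by rewrite expr2 invfM scaleNr.
Qed.

Lemma Ck_sum k n (F : 'I_n -> V -> R) : (forall i, Ck k U (F i)) ->
  Ck k U (fun x => \sum_i F i x).
Proof.
move=> hF.
suff H s : Ck k U (fun x => \sum_(i <- s) F i x) by exact: H.
elim: s => [|i s IH].
  by apply: Ck_ext (Ck_cst U k 0) => // x _; rewrite big_nil.
by apply: Ck_ext (Ck_add oU (hF i) IH) => // x _; rewrite big_cons.
Qed.

End CkReal.

Lemma Ck_coord (R : realType) (V : normedModType R) (U : set V) p q k
    (F : V -> 'M[R]_(p, q)) i j : open U ->
  Ck k U F -> Ck k U (fun x => F x i j).
Proof.
move=> oU; elim: k F => [|k IH] F /=.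
  move=> cF x Ux; apply: (@continuous_comp _ _ _ F (fun A => A i j)).
    exact: cF.
  exact: (differentiable_continuous (differentiable_coord (F x) i j)).
case=> dF DF; split=> [x Ux|v].
  apply: (@differentiable_comp _ _ _ _ F (fun A => A i j)); first exact: dF.
  exact: differentiable_coord.
apply: Ck_ext (IH _ (DF v)) => // y Uy.
by rewrite derive_mx ?mxE //; apply: diff_derivable; exact: dF.
Qed.

(** * Symmetry of second derivatives *)

Section Schwarz.
Variables (R : realType) (V : normedModType R) (U : set V).
Hypothesis oU : open U.
Implicit Types (f g : V -> R) (x v w : V).

Lemma is_derive_line g x v (s : R) : differentiable g (x + s *: v) ->
  is_derive s 1 (fun s : R => g (x + s *: v)) ('D_v g (x + s *: v)).
Proof.
move=> dg; have dgv : derivable g (x + s *: v) v by exact: diff_derivable.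
have e : (fun h : R => h^-1 *: (((fun s : R => g (x + s *: v)) \o shift s) (h *: 1)
      - g (x + s *: v)))
    = (fun h : R => h^-1 *: ((g \o shift (x + s *: v)) (h *: v) - g (x + s *: v))).
  apply/funext => h /=; congr (_ *: (g _ - _)).
  by rewrite [h *: 1]mulr1 scalerDl addrCA.
by split; rewrite /derivable /derive e.
Qed.

Lemma mean_value (phi dphi : R -> R) (h : R) : 0 < h ->
  (forall s, 0 <= s <= h -> is_derive s 1 phi (dphi s)) ->
  exists2 a, 0 <= a <= h & phi h - phi 0 = dphi a * h.
Proof.
move=> h0 dp; have [s||a] := @MVT R phi dphi 0 h h0.
- by rewrite in_itv /= => /andP[s0 sh]; apply: dp; rewrite !ltW.
- apply: derivable_within_continuous => s; rewrite in_itv /= => hs.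
  by have [] := dp s hs.
- by rewrite in_itv /= subr0 => /andP[a0 ah] ->; exists a; rewrite ?ltW.
Qed.

(** Apply the mean value theorem in the direction v to the difference of f
    between two parallel segments, then in the direction w. *)
Lemma second_difference f x v w (h : R) : 0 < h -> Ck 2 U f ->
  (forall a b, 0 <= a <= h -> 0 <= b <= h -> U (x + a *: v + b *: w)) ->
  exists a b, [/\ 0 <= a <= h, 0 <= b <= h &
    f (x + h *: v + h *: w) - f (x + h *: v) - f (x + h *: w) + f x
    = h * h * 'D_w ('D_v f) (x + a *: v + b *: w)].
Proof.
move=> h0 [df Df] hU; have [dvf Dvf] := Df v.
have h00 : 0 <= (0 : R) <= h by rewrite lexx ltW.
have hh : 0 <= h <= h by rewrite lexx ltW.
have U0 a : 0 <= a <= h -> U (x + a *: v).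
  by move=> /hU /(_ h00); rewrite scale0r addr0.
have d1 s : 0 <= s <= h -> is_derive s 1
    (fun s : R => f (x + h *: w + s *: v) - f (x + s *: v))
    ('D_v f (x + h *: w + s *: v) - 'D_v f (x + s *: v)).
  move=> hs; apply: is_deriveB; apply: is_derive_line; apply: df; last exact: U0.
  by rewrite addrAC; exact: hU.
have [a ha Ea] := mean_value h0 d1.
have d2 s : 0 <= s <= h -> is_derive s 1
    (fun s : R => 'D_v f (x + a *: v + s *: w)) ('D_w ('D_v f) (x + a *: v + s *: w)).
  by move=> hs; apply: is_derive_line; apply: dvf; exact: hU.
have [b hb Eb] := mean_value h0 d2.
exists a, b; split=> //.
move: Ea Eb; rewrite !scale0r !addr0 (addrAC x (h *: w) (h *: v)).
rewrite (addrAC x (h *: w) (a *: v)) => Ea Eb.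
by move: Ea; rewrite Eb => Ea; rewrite mulrC mulrA -Ea; ring.
Qed.

Lemma dist_triangle_half (p q r e : R) :
  `|p - r| < e / 2 -> `|q - r| < e / 2 -> `|p - q| <= e.
Proof.
move=> pr qr; rewrite -(subrKA r p) (le_trans (ler_normD _ _)) //.
by rewrite [leRHS]splitr distrC [X in _ + X]distrC lerD // ltW // distrC.
Qed.

(** The second difference is symmetric in v and w, so [second_difference] makes
    the two mixed derivatives agree at some pair of points near x; let the
    points tend to x. *)
Lemma schwarz f x v w : Ck 2 U f -> U x -> 'D_w ('D_v f) x = 'D_v ('D_w f) x.
Proof.
move=> C2f Ux; have [_ Df] := C2f.
have cont p q : {for x, continuous ('D_p ('D_q f))}.
  by have [_ /(_ p) cf] := Df q; exact: cf.
apply/eqP; rewrite -subr_eq0 -normr_le0; apply/ler_addgt0Pl => e e0.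
rewrite addr0.
have e20 : 0 < e / 2 by rewrite divr_gt0.
have nA : \forall y \near x, `|'D_w ('D_v f) x - 'D_w ('D_v f) y| < e / 2.
  by move/cvgrPdist_lt : (cont w v); apply.
have nB : \forall y \near x, `|'D_v ('D_w f) x - 'D_v ('D_w f) y| < e / 2.
  by move/cvgrPdist_lt : (cont v w); apply.
have nUAB : nbhs x (U `&` ([set y | `|'D_w ('D_v f) x - 'D_w ('D_v f) y| < e / 2]
    `&` [set y | `|'D_v ('D_w f) x - 'D_v ('D_w f) y| < e / 2])).
  by apply: filterI (near_open oU Ux) _; exact: filterI nA nB.
have [r /= r0 hr] := (nbhs_ballP _ _).1 nUAB.
(* The summand 1 keeps h well defined when both v and w vanish. *)
pose h := r / (`|v| + `|w| + 1).
have N0 : 0 < `|v| + `|w| + 1 by rewrite ltr_wpDl // addr_ge0.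
have h0 : 0 < h by rewrite divr_gt0.
have near_h a b : 0 <= a <= h -> 0 <= b <= h ->
    ball x r (x + a *: v + b *: w).
  move=> /andP[a0 ah] /andP[b0 bh]; rewrite -ball_normE /= -addrA opprD addrA subrr add0r.
  rewrite normrN.
  apply: (le_lt_trans (ler_normD _ _)); rewrite !normrZ !ger0_norm //.
  have -> : r = h * (`|v| + `|w| + 1) by rewrite /h divfK // gt_eqF.
  rewrite !mulrDr mulr1.
  have := ler_wpM2r (normr_ge0 v) ah; have := ler_wpM2r (normr_ge0 w) bh; lra.
move: (h) h0 near_h => {}h {}h0 {}near_h.
have Uvw a b (ha : 0 <= a <= h) (hb : 0 <= b <= h) : U (x + a *: v + b *: w).
  by have [] := hr _ (near_h a b ha hb).
have Uwv a b (ha : 0 <= a <= h) (hb : 0 <= b <= h) : U (x + a *: w + b *: v).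
  by rewrite addrAC; exact: Uvw.
have [a [b [ha hb Eab]]] := second_difference h0 C2f Uvw.
have [a' [b' [ha' hb' Eab']]] := second_difference h0 C2f Uwv.
have E : 'D_w ('D_v f) (x + a *: v + b *: w) = 'D_v ('D_w f) (x + b' *: v + a' *: w).
  have hh : h * h != 0 by rewrite mulf_neq0 // gt_eqF.
  rewrite (addrAC x (h *: w)) (addrAC x (a' *: w)) in Eab'.
  by apply: (mulfI hh); apply: etrans (esym Eab) (etrans _ Eab'); rewrite [X in X + _]addrAC.
have [_ [A _]] := hr _ (near_h a b ha hb).
have [_ [_ B]] := hr _ (near_h b' a' hb' ha').
have {}A := eq_ind _ (fun c => `|'D_w ('D_v f) x - c| < e / 2) A _ E.
exact: dist_triangle_half A B.
Qed.

End Schwarz.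

(** * Chain rule and composition *)

Lemma pair_sum_delta (R : realType) n (q : 'rV[R]_n) :
  (0, q) = \sum_k q 0 k *: (0, delta_mx 0 k) :> R * 'rV[R]_n.
Proof.
rewrite {1}(row_sum_delta q).
rewrite (big_morph (fun x => (0 : R, x)) (id1 := 0) (op1 := +%R)) //.
  by apply: eq_bigr => k _; congr pair; rewrite /= ?scaler0.
by move=> x y; congr pair; rewrite /= addr0.
Qed.

Section Composition.
Variables (R : realType) (V : normedModType R) (n : nat).
Variables (U : set V) (U' : set (R * 'rV[R]_n)).
Hypotheses (oU : open U) (oU' : open U').
Variables (a : V -> R) (Y : V -> 'rV[R]_n).
Hypothesis UU' : forall z, U z -> U' (a z, Y z).

Lemma chain_rule (phi : R * 'rV[R]_n -> R) v z :
  differentiable a z -> differentiable Y z -> differentiable phi (a z, Y z) ->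
  'D_v (fun z => phi (a z, Y z)) z =
    'D_v a z * 'D_(1, 0) phi (a z, Y z)
    + \sum_k ('D_v Y z) 0 k * 'D_(0, delta_mx 0 k) phi (a z, Y z).
Proof.
move=> da dY dphi.
have dp : differentiable (fun z => (a z, Y z)) z by exact: differentiable_pair.
have dc : differentiable (fun z => phi (a z, Y z)) z.
  exact: (@differentiable_comp _ _ _ _ (fun z => (a z, Y z)) phi).
rewrite deriveE // (@diff_comp _ _ _ _ (fun z => (a z, Y z)) phi) //=.
rewrite diff_pair //= !(deriveE _ da) !(deriveE _ dY) !(deriveE _ dphi).
under eq_bigr do rewrite (deriveE _ dphi).
set L := 'd phi _; set p := 'd a z v; set q := 'd Y z v.
have -> : (p, q) = p *: (1, 0) + \sum_k q 0 k *: (0, delta_mx 0 k) :> R * 'rV[R]_n.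
  rewrite -pair_sum_delta.
  by congr pair; rewrite /= ?addr0 ?scaler0 ?add0r // [RHS]mulr1.
rewrite linearD linearZ linear_sum /=; congr (_ + _).
by apply: eq_bigr => k _; rewrite linearZ.
Qed.

Lemma Ck_comp k (phi : R * 'rV[R]_n -> R) :
  Ck k U a -> Ck k U Y -> Ck k U' phi -> Ck k U (fun z => phi (a z, Y z)).
Proof.
elim: k phi => [|k IH] phi.
  move=> ca cY cphi z Uz; apply: (@continuous_comp _ _ _ (fun z => (a z, Y z)) phi).
    exact: cvg_pair (ca z Uz) (cY z Uz).
  by apply: cphi; exact: UU'.
move=> ha hY hphi; have [da Da] := ha; have [dY DY] := hY; have [dphi Dphi] := hphi.
have ha' := CkW ha; have hY' := CkW hY.
split=> [z Uz|v].
  apply: (@differentiable_comp _ _ _ _ (fun z => (a z, Y z)) phi).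
    by apply: differentiable_pair; [exact: da|exact: dY].
  by apply: dphi; exact: UU'.
apply: Ck_ext (Ck_add oU (Ck_mul oU (Da v) (IH _ ha' hY' (Dphi (1, 0))))
  (Ck_sum oU (fun k => Ck_mul oU (Ck_coord 0 k oU (DY v))
     (IH _ ha' hY' (Dphi (0, delta_mx 0 k)))))) => // z Uz.
by rewrite chain_rule //; [exact: da|exact: dY|apply: dphi; exact: UU'].
Qed.

End Composition.

(** * The ring of smooth functions on an open set *)

Section SmoothRing.
Variables (R : realType) (V : normedModType R) (U : set V) (oU : open U).

(** Functions vanish off U, so that functions with the same restriction to U are
    equal. *)
Record sfun (oU : open U) := Sfun {
  sf :> V -> R;
  sfun_smooth : smooth_on U sf;
  sf_off : forall x, ~ U x -> sf x = 0 }.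

Local Notation K := (sfun oU).

Lemma sfun_eq (a b : K) : (forall x, U x -> a x = b x) -> a = b.
Proof.
move=> ab; have e : sf a = sf b.
  apply/funext => x; have [/ab //|nUx] := pselect (U x).
  by rewrite !sf_off.
case: a b e {ab} => [f sfm of_] [g sg og] /= e; case: _ / e in sg og *.
by congr Sfun; exact: Prop_irrelevance.
Qed.

Definition cut (f : V -> R) : V -> R := fun x => if pselect (U x) then f x else 0.

Lemma cutE f x : U x -> cut f x = f x.
Proof. by rewrite /cut; case: pselect. Qed.

Lemma cut_smooth f : smooth_on U f -> smooth_on U (cut f).
Proof. by move=> sfm k; apply: (Ck_ext oU) (sfm k) => y Uy; rewrite cutE. Qed.

Lemma cut_off f x : ~ U x -> cut f x = 0.
Proof. by rewrite /cut; case: pselect. Qed.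

Lemma mk_sfun_sig f (sf : smooth_on U f) : {a : K | forall x, U x -> a x = f x}.
Proof.
by exists (Sfun oU (cut_smooth sf) (@cut_off f)) => x Ux; exact: cutE.
Qed.

(** The witness is taken from an opaque proof here, and likewise in [dsf] and
    [pullback]: otherwise unification would unfold and compare derivatives. *)
Definition mk_sfun f (sf : smooth_on U f) : K := sval (mk_sfun_sig sf).

Lemma mk_sfunE f (sf : smooth_on U f) x : U x -> mk_sfun sf x = f x.
Proof. exact: (svalP (mk_sfun_sig sf)). Qed.

HB.instance Definition _ := gen_eqMixin K.
HB.instance Definition _ := gen_choiceMixin K.

Definition cst_sf (c : R) : K := mk_sfun (fun k => Ck_cst U k c).
Definition add_sf (a b : K) : K :=
  mk_sfun (fun k => Ck_add oU (sfun_smooth a k) (sfun_smooth b k)).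
Definition opp_sf (a : K) : K := mk_sfun (fun k => Ck_opp oU (sfun_smooth a k)).
Definition mul_sf (a b : K) : K :=
  mk_sfun (fun k => Ck_mul oU (sfun_smooth a k) (sfun_smooth b k)).

Let addA : associative add_sf.
Proof. by move=> a b c; apply: sfun_eq => x Ux; rewrite !mk_sfunE // addrA. Qed.
Let addC : commutative add_sf.
Proof. by move=> a b; apply: sfun_eq => x Ux; rewrite !mk_sfunE // addrC. Qed.
Let add0 : left_id (cst_sf 0) add_sf.
Proof. by move=> a; apply: sfun_eq => x Ux; rewrite !mk_sfunE // add0r. Qed.
Let addN : left_inverse (cst_sf 0) opp_sf add_sf.
Proof. by move=> a; apply: sfun_eq => x Ux; rewrite !mk_sfunE // addNr. Qed.

HB.instance Definition _ := GRing.isZmodule.Build K addA addC add0 addN.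

Let mulA : associative mul_sf.
Proof. by move=> a b c; apply: sfun_eq => x Ux; rewrite !mk_sfunE // mulrA. Qed.
Let mulC : commutative mul_sf.
Proof. by move=> a b; apply: sfun_eq => x Ux; rewrite !mk_sfunE // mulrC. Qed.
Let mul1 : left_id (cst_sf 1) mul_sf.
Proof. by move=> a; apply: sfun_eq => x Ux; rewrite !mk_sfunE // mul1r. Qed.
Let mulD : left_distributive mul_sf add_sf.
Proof. by move=> a b c; apply: sfun_eq => x Ux; rewrite !mk_sfunE // mulrDl. Qed.

HB.instance Definition _ := GRing.Zmodule_isComPzRing.Build K mulA mulC mul1 mulD.

Definition ev x of U x := fun a : K => a x.

Section Eval.
Variables (x : V) (Ux : U x).

Fact ev_zmod : zmod_morphism (ev Ux).
Proof. by move=> a b; rewrite /ev [LHS]mk_sfunE // mk_sfunE. Qed.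
Fact ev_monoid : monoid_morphism (ev Ux).
Proof. by split=> [|a b]; rewrite /ev [LHS]mk_sfunE. Qed.

HB.instance Definition _ := GRing.isZmodMorphism.Build K R (ev Ux) ev_zmod.
HB.instance Definition _ := GRing.isMonoidMorphism.Build K R (ev Ux) ev_monoid.

End Eval.

Lemma ev_inj (a b : K) : (forall x (Ux : U x), ev Ux a = ev Ux b) -> a = b.
Proof. by move=> ab; apply: sfun_eq => x Ux; exact: ab. Qed.

Lemma ev_mx_inj p q (A B : 'M[K]_(p, q)) :
  (forall x (Ux : U x), map_mx (ev Ux) A = map_mx (ev Ux) B) -> A = B.
Proof.
move=> AB; apply/matrixP => i j; apply: ev_inj => x Ux.
by move/matrixP: (AB x Ux) => /(_ i j); rewrite !mxE.
Qed.

Lemma sfun_differentiable (a : K) x : U x -> differentiable (a : V -> R) x.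
Proof. by have [da _] := sfun_smooth a 1; exact: da. Qed.

Lemma dsf_sig (v : V) (a : K) :
  {b : K | forall x, U x -> b x = 'D_v (a : V -> R) x}.
Proof.
by exists (mk_sfun (fun k => let: conj _ h := sfun_smooth a k.+1 in h v)) => x; exact: mk_sfunE.
Qed.

Definition dsf (v : V) (a : K) : K := sval (dsf_sig v a).

Lemma dsfE v (a : K) x : U x -> dsf v a x = 'D_v (a : V -> R) x.
Proof. exact: (svalP (dsf_sig v a)). Qed.

Lemma dsf_derivation v : derivation (dsf v).
Proof.
split=> a b; apply: sfun_eq => x Ux.
  have da := @diff_derivable _ _ _ (a : V -> R) x v (sfun_differentiable a Ux).
  have db := @diff_derivable _ _ _ (b : V -> R) x v (sfun_differentiable b Ux).
  rewrite [RHS]mk_sfunE // !dsfE // -(deriveD da db).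
  by apply: (eq_on_derive oU) => // y Uy; rewrite [LHS]mk_sfunE.
have da := @diff_derivable _ _ _ (a : V -> R) x v (sfun_differentiable a Ux).
have db := @diff_derivable _ _ _ (b : V -> R) x v (sfun_differentiable b Ux).
rewrite [RHS]mk_sfunE // [in RHS]mk_sfunE // [X in _ + X]mk_sfunE // !dsfE //.
rewrite [in RHS]addrC [X in _ + X]mulrC -(deriveM da db).
by apply: (eq_on_derive oU) => // y Uy; rewrite [LHS]mk_sfunE.
Qed.

Lemma dsfC v w a : dsf v (dsf w a) = dsf w (dsf v a).
Proof.
have e p q x (Ux : U x) : dsf p (dsf q a) x = 'D_p ('D_q (a : V -> R)) x.
  rewrite dsfE //; apply: (eq_on_derive oU) Ux; exact: dsfE.
apply: sfun_eq => x Ux.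
exact: etrans (e v w x Ux) (etrans (schwarz oU w v (sfun_smooth a 2) Ux) (esym (e w v x Ux))).
Qed.

Lemma inverse_sf (a : K) : (forall x, U x -> a x != 0) -> exists b, b * a = 1.
Proof.
move=> a0; exists (mk_sfun (fun k => Ck_inv oU a0 (sfun_smooth a k))).
by apply: sfun_eq => x Ux; rewrite !mk_sfunE // mulVf // a0.
Qed.

(** The determinant has a smooth inverse, and Cramer's rule does the rest. *)
Lemma inverse_mx n (g : 'M[K]_n) :
  (forall x (Ux : U x), map_mx (ev Ux) g \in unitmx) -> exists gi, gi *m g = 1%:M.
Proof.
move=> gU; have [x Ux|b bg] := @inverse_sf (\det g).
  by have := gU x Ux; rewrite unitmxE det_map_mx unitfE.
by exists (b *: \adj g); rewrite -scalemxAl mul_adj_mx scale_scalar_mx bg.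
Qed.

Definition mk_mx p q (F : V -> 'M[R]_(p, q)) (sF : smooth_on U F) : 'M[K]_(p, q) :=
  \matrix_(i, j) mk_sfun (fun k => Ck_coord i j oU (sF k)).

Lemma mk_mxE p q (F : V -> 'M[R]_(p, q)) (sF : smooth_on U F) x (Ux : U x) :
  map_mx (ev Ux) (mk_mx sF) = F x.
Proof. by apply/matrixP => i j; rewrite !mxE /ev mk_sfunE. Qed.

Lemma dsf_mk f (sf : smooth_on U f) v x (Ux : U x) :
  ev Ux (dsf v (mk_sfun sf)) = 'D_v f x.
Proof.
by rewrite /ev dsfE //; apply: (eq_on_derive oU) Ux => y Uy; rewrite mk_sfunE.
Qed.

Lemma dsf_mk_mx p q (F : V -> 'M[R]_(p, q)) (sF : smooth_on U F) v x (Ux : U x) :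
  map_mx (ev Ux) (map_mx (dsf v) (mk_mx sF)) = 'D_v F x.
Proof.
have [dF _] := sF 1; rewrite derive_mx; last by apply: diff_derivable; exact: dF.
by apply/matrixP => i j; rewrite !mxE dsf_mk.
Qed.

End SmoothRing.

Arguments ev : simpl never.
Arguments mk_sfun : simpl never.
Arguments dsf : simpl never.
Arguments cst_sf : simpl never.

(** Pullback along z |-> (a z, Y z), as a morphism between rings of functions. *)
Section Pullback.
Variables (R : realType) (V : normedModType R) (n : nat).
Variables (U : set V) (U' : set (R * 'rV[R]_n)) (oU : open U) (oU' : open U').
Variables (a : V -> R) (Y : V -> 'rV[R]_n).
Hypotheses (sa : smooth_on U a) (sY : smooth_on U Y).
Hypothesis UU' : forall z, U z -> U' (a z, Y z).

Lemma pullback_sig (b : sfun oU') :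
  {c : sfun oU | forall z, U z -> c z = b (a z, Y z)}.
Proof.
exists (mk_sfun oU (fun k => Ck_comp oU UU' (sa k) (sY k) (sfun_smooth b k))) => z.
exact: mk_sfunE.
Qed.

Definition pullback (b : sfun oU') : sfun oU := sval (pullback_sig b).

Lemma pullbackE b z : U z -> pullback b z = b (a z, Y z).
Proof. exact: (svalP (pullback_sig b)). Qed.

Arguments pullback : simpl never.

Fact pullback_zmod : zmod_morphism pullback.
Proof.
move=> b c; apply: sfun_eq => z Uz.
rewrite pullbackE // [RHS]mk_sfunE // pullbackE // [in RHS]mk_sfunE // pullbackE //
  mk_sfunE ?mk_sfunE //; exact: UU'.
Qed.
Fact pullback_monoid : monoid_morphism pullback.
Proof.
split=> [|b c]; apply: sfun_eq => z Uz.
  by rewrite pullbackE // !mk_sfunE //; exact: UU'.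
by rewrite pullbackE // [RHS]mk_sfunE // !pullbackE // mk_sfunE //; exact: UU'.
Qed.

HB.instance Definition _ :=
  GRing.isZmodMorphism.Build (sfun oU') (sfun oU) pullback pullback_zmod.
HB.instance Definition _ :=
  GRing.isMonoidMorphism.Build (sfun oU') (sfun oU) pullback pullback_monoid.

Lemma dsf_pullback v b : dsf v (pullback b) =
  dsf v (mk_sfun oU sa) * pullback (dsf ((1, 0) : R * 'rV[R]_n) b)
  + \sum_k dsf v (mk_mx oU sY 0 k) * pullback (dsf ((0, delta_mx 0 k) : R * 'rV[R]_n) b).
Proof.
apply: ev_inj => z Uz; rewrite rmorphD rmorphM rmorph_sum /=.
have Uz' := UU' Uz; have [dY _] := sY 1; have [da _] := sa 1.
have -> : ev Uz (dsf v (pullback b)) = 'D_v (fun z => b (a z, Y z)) z.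
  by rewrite /ev dsfE //; apply: (eq_on_derive oU) Uz; exact: pullbackE.
rewrite (chain_rule _ (da z Uz) (dY z Uz) (sfun_differentiable b Uz')).
congr (_ + _); last apply: eq_bigr => k _; rewrite ?rmorphM /=; congr (_ * _).
- rewrite /ev dsfE //; apply: (eq_on_derive oU) Uz => y Uy; by rewrite mk_sfunE.
- by rewrite /ev pullbackE // dsfE.
- rewrite /ev dsfE // derive_mx; last by apply: diff_derivable; exact: dY.
  by rewrite mxE; apply: (eq_on_derive oU) Uz => y Uy; rewrite mxE mk_sfunE.
- by rewrite /ev pullbackE // dsfE.
Qed.

Lemma pullback_mxE p q (A : 'M[sfun oU']_(p, q)) z (Uz : U z) :
  map_mx (ev Uz) (map_mx pullback A) = map_mx (ev (UU' Uz)) A.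
Proof. by apply/matrixP => i j; rewrite !mxE /ev pullbackE. Qed.

End Pullback.

Arguments pullback : simpl never.

(** * Local Riemannian geometry in the ring of smooth functions *)

(** These two identities equate difference quotients, hence hold for any q. *)
Section Slices.
Variables (R : realType) (n : nat) (W : normedModType R).
Implicit Types q : R * 'rV[R]_n -> W.

Lemma derive_space q t x v :
  'D_v (fun y => q (t, y)) x = 'D_(0, v) q (t, x).
Proof.
rewrite /derive; apply: (congr1 (fun k : R -> W => lim (k @ 0^'))); apply/funext => h /=.
by congr (_ *: (q _ - _)); congr pair; rewrite /= scaler0 add0r.
Qed.

Lemma derive_time q t x :
  (fun s => q (s, x))^`() t = 'D_(1, 0) q (t, x).
Proof.
rewrite derive1E /derive; apply: (congr1 (fun k : R -> W => lim (k @ 0^'))); apply/funext => h /=.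
by congr (_ *: (q _ - _)); congr pair; rewrite /= scaler0 add0r.
Qed.

End Slices.

Section DirectionalSum.
Variables (R : realType) (n : nat) (U : set (R * 'rV[R]_n)) (oU : open U).

Lemma dsf_direction (a : sfun oU) v : dsf (0, v) a =
  \sum_k cst_sf oU (v 0 k) * dsf (0, delta_mx 0 k) a.
Proof.
apply: ev_inj => z Uz; rewrite rmorph_sum /=.
have da := sfun_differentiable a Uz.
have e w : ev Uz (dsf w a) = 'd (a : _ -> R) z w.
  exact: etrans (dsfE _ _ Uz) (deriveE _ da).
under eq_bigr do rewrite rmorphM /= e.
rewrite e.
rewrite pair_sum_delta.
rewrite linear_sum; apply: eq_bigr => k _ /=.
by rewrite linearZ /ev mk_sfunE.
Qed.

End DirectionalSum.

Lemma gradient_mul (R : realType) n (G : 'rV[R]_n -> 'M[R]_n) q x :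
  gradient G q x = (\row_i pd i q x) *m (invmx (G x))^T.
Proof.
apply/matrixP => i j; rewrite !mxE; apply: eq_bigr => k _.
by rewrite !mxE mulrC.
Qed.

Section Ambient.
Variables (R : realType) (n : nat) (U0 : set 'rV[R]_n).
Local Notation U := [set z : R * 'rV[R]_n | U0 z.2].
Variables (oU0 : open U0) (oU : open U).
Variable G : R -> 'rV[R]_n -> 'M[R]_n.
Hypothesis G_smooth : smooth_on U (fun z => G z.1 z.2).
Hypothesis G_sym : forall t x, U0 x -> (G t x)^T = G t x.
Variable gi : 'M[sfun oU]_n.
Local Notation K := (sfun oU).
Local Notation d := (fun i : 'I_n => @dsf _ _ _ oU (0, delta_mx 0 i)).
Local Notation dt := (@dsf _ _ _ oU (1, 0)).
Definition gmx : 'M[K]_n := mk_mx oU G_smooth.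
Definition half_sfun : K := cst_sf oU 2^-1.
Local Notation g := gmx.
Local Notation half := half_sfun.
Hypothesis inverse_metric : gi *m g = 1%:M.

Lemma half_sfun_double : half + half = 1.
Proof.
apply: ev_inj => z Uz; rewrite rmorphD rmorph1 /=.
by rewrite /ev mk_sfunE // [RHS]splitr div1r.
Qed.

Lemma gmx_sym : g^T = g.
Proof.
by apply: ev_mx_inj => z Uz; rewrite -map_trmx mk_mxE G_sym.
Qed.

Section At.
Variables (t : R) (x : 'rV[R]_n) (Ux : U0 x).
Let Uz : U (t, x) := Ux.

(** The tool that transfers iterated partial derivatives: any function that
    agrees with an element of the ring on the time slice may be used. *)
Lemma pd_sf (q : 'rV[R]_n -> R) (a : K) i : (forall y, U0 y -> q y = a (t, y)) ->
  pd i q x = ev Uz (d i a).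
Proof.
move=> qa; by rewrite /pd (eq_on_derive oU0 _ qa Ux) derive_space /ev (dsfE _ _ Uz).
Qed.

Lemma gmxE : map_mx (ev Uz) g = G t x. Proof. exact: mk_mxE. Qed.

Lemma inverse_metricE : map_mx (ev Uz) gi = invmx (G t x).
Proof. by apply: left_inverse_invmx; rewrite -gmxE -map_mxM inverse_metric map_mx1. Qed.

Lemma christoffelE k i j : christoffel (G t) k i j x = ev Uz (gamma d half g gi k i j).
Proof.
rewrite rmorphM rmorph_sum /=; congr (_ * _); first by rewrite /ev mk_sfunE.
apply: eq_bigr => l _; rewrite rmorphM rmorphB rmorphD /=; congr (_ * _).
  by rewrite -inverse_metricE mxE.
have dg a b e : pd a (fun y => G t y b e) x = ev Uz (d a (g b e)).
  by apply: pd_sf => y Uy; rewrite mxE mk_sfunE.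
by rewrite !dg.
Qed.

End At.

Section At2.
Variables (t : R) (x : 'rV[R]_n) (Ux : U0 x).
Let Uz : U (t, x) := Ux.

Lemma riemannE i j k l : riemann (G t) i j k l x = ev Uz (curvature d half g gi i j k l).
Proof.
rewrite curvature_gamma rmorphD rmorphB rmorph_sum /=; congr (_ - _ + _).
- by apply: pd_sf => y Uy; exact: christoffelE.
- by apply: pd_sf => y Uy; exact: christoffelE.
apply: eq_bigr => a _; rewrite rmorphB.
by congr (_ - _); rewrite rmorphM; congr (_ * _); exact: christoffelE.
Qed.

Lemma ricciE : map_mx (ev Uz) (ricci_mx d half g gi) = ricci (G t) x.
Proof.
apply/matrixP => j k; rewrite !mxE rmorph_sum /=.
by apply: eq_bigr => i _; rewrite riemannE.
Qed.

Lemma hessianE (f : K) (q : 'rV[R]_n -> R) : (forall y, U0 y -> q y = f (t, y)) ->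
  map_mx (ev Uz) (hess_mx d half g gi f) = hessian (G t) q x.
Proof.
move=> qf; apply/matrixP => i j; rewrite !mxE rmorphB rmorph_sum /=.
congr (_ - _).
  by apply/esym/pd_sf => y Uy; exact: (pd_sf (t := t) Uy _ qf).
apply: eq_bigr => k _; rewrite rmorphM; congr (_ * _).
  exact/esym/christoffelE.
exact/esym/pd_sf.
Qed.

Lemma differentialE (f : K) (q : 'rV[R]_n -> R) : (forall y, U0 y -> q y = f (t, y)) ->
  map_mx (ev Uz) (differential d f) = \row_i pd i q x.
Proof. by move=> qf; apply/matrixP => i j; rewrite !mxE (pd_sf Ux _ qf). Qed.

Lemma gradientE (f : K) (q : 'rV[R]_n -> R) : (forall y, U0 y -> q y = f (t, y)) ->
  map_mx (ev Uz) (grad d gi f) = gradient (G t) q x.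
Proof.
move=> qf; rewrite gradient_mul trmx_inv (G_sym t Ux) map_mxM.
by rewrite (differentialE qf) inverse_metricE.
Qed.

End At2.

Lemma scalar_curvatureE t x (Ux : U0 x) :
  scalar_curvature (G t) x = (scalar_curv d half g gi) (t, x).
Proof.
have Uz : U (t, x) := Ux.
rewrite -[RHS]/(ev Uz _) rmorph_sum; apply: eq_bigr => i _.
rewrite rmorph_sum; apply: eq_bigr => j _.
by rewrite rmorphM /= -(inverse_metricE t Ux) -(ricciE t Ux) !mxE.
Qed.

Lemma derive_slice t x (Ux : U0 x) (f : K) (q : 'rV[R]_n -> R) N :
  (forall y, U0 y -> q y = f (t, y)) ->
  'D_N q x = \sum_k N 0 k * (d k f) (t, x).
Proof.
move=> qf; have Uz : U (t, x) := Ux.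
rewrite (eq_on_derive oU0 _ qf Ux) derive_space -(dsfE _ _ Uz).
rewrite dsf_direction -[LHS]/(ev Uz _) rmorph_sum; apply: eq_bigr => k _.
by rewrite rmorphM /= /ev mk_sfunE.
Qed.

End Ambient.

(** * Gradient steady solitons in a chart *)

Lemma Ck_subset (R : realType) (V W : normedModType R) (U U' : set V) k (f : V -> W) :
  U `<=` U' -> Ck k U' f -> Ck k U f.
Proof.
move=> UU'; elim: k f => [|k IH] f /=; first by move=> cf x /UU'; exact: cf.
by case=> df Df; split=> [x /UU'|v]; [exact: df|exact: IH].
Qed.

Lemma differentiable_fst (R : realType) (V W : normedModType R) (z : V * W) :
  differentiable (fst : V * W -> V) z.
Proof.
by apply: (@linear_differentiable R (V * W)%type V fst) => x; exact: cvg_fst.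
Qed.

Lemma derive_fst (R : realType) (V W : normedModType R) (v z : V * W) :
  'D_v (fst : V * W -> V) z = v.1.
Proof.
rewrite (deriveE _ (differentiable_fst z)) (@diff_lin R (V * W)%type V fst) //.
by move=> x; exact: cvg_fst.
Qed.

Lemma Ck_fst (R : realType) (V W : normedModType R) (U : set (V * W)) k :
  Ck k U (fst : V * W -> V).
Proof.
case: k => [|k] /=.
  by move=> z _; apply: differentiable_continuous; exact: differentiable_fst.
split=> [z _|v]; first exact: differentiable_fst.
have -> : (fun z => 'D_v (fst : V * W -> V) z) = fun _ => v.1; last exact: Ck_cst.
by apply/funext => z; exact: derive_fst.
Qed.

Lemma row_jacobian (R : realType) m n (X : 'rV[R]_m -> 'rV[R]_n) u i :
  differentiable X u -> row i ('J X u) = 'D_(delta_mx 0 i) X u.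
Proof. by move=> dX; rewrite deriveEjacobian // -rowE. Qed.

Lemma posdef_unit (R : realType) n (B : 'M[R]_n) :
  (forall v, v != 0 -> 0 < bil B v v) -> B \in unitmx.
Proof.
move=> posB; rewrite -row_free_unit -kermx_eq0; apply/rowV0P => v /sub_kermxP vB.
apply/eqP; apply: contraT => /posB; by rewrite /bil vB mul0mx mxE ltxx.
Qed.

Section Soliton.
Variables (R : realType) (n : nat) (M : manifold R n).
Variables (g : metric_family M) (f : R -> M -> R).
Hypothesis soliton : gradient_steady_soliton g f.
Variable c : chart M.
Local Notation U := [set z : R * 'rV[R]_n | img c z.2].

Let oU0 : open (img c) := @img_open R n M c.

Lemma chart_time_open : open U.
Proof.
by apply: (@open_comp (R * 'rV[R]_n)%type _ snd) => // z _; exact: cvg_snd.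
Qed.

Local Notation oU := chart_time_open.
Local Notation K := (sfun oU).
Local Notation d := (fun i : 'I_n => @dsf _ _ _ oU (0, delta_mx 0 i)).
Local Notation dt := (@dsf _ _ _ oU (1, 0)).
Local Notation gK := (gmx oU (metric_smooth g c)).
Local Notation half := (half_sfun oU).

Let G_sym t x : img c x -> (g c t x)^T = g c t x.
Proof. exact: Defs.metric_sym. Qed.

Lemma metric_inverse : exists gi : 'M[K]_n, gi *m gK = 1%:M.
Proof.
apply: inverse_mx => -[t x] Ux; rewrite mk_mxE; apply: posdef_unit.
exact: metric_posdef.
Qed.

Definition potential : K := mk_sfun oU (potential_smooth soliton c).
Local Notation p := potential.

Lemma potentialE t x : img c x -> (f t \o par c) x = p (t, x).
Proof. by move=> Ux; rewrite mk_sfunE. Qed.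

Variable gi : 'M[K]_n.
Hypothesis inverse_metric : gi *m gK = 1%:M.

Lemma soliton_sf : ricci_mx d half gK gi + hess_mx d half gK gi p = 0.
Proof.
apply: ev_mx_inj => -[t x] Ux; rewrite map_mxD map_mx0 (ricciE oU0 inverse_metric).
by rewrite (hessianE oU0 inverse_metric Ux (@potentialE t)) soliton_equation.
Qed.

Lemma ricci_flow_sf : map_mx dt gK = - (ricci_mx d half gK gi + ricci_mx d half gK gi).
Proof.
apply: ev_mx_inj => -[t x] Ux; rewrite dsf_mk_mx map_mxN map_mxD (ricciE oU0 inverse_metric).
rewrite -(derive_time (fun z => g c z.1 z.2)) (ricci_flow soliton) //.
by rewrite scaleNr -mulr2n scaler_nat.
Qed.

Lemma potential_flow_sf : dt p = (grad d gi p *m (differential d p)^T) 0 0.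
Proof.
apply: ev_inj => -[t x] Ux; rewrite dsf_mk.
rewrite -(derive_time (fun z => f z.1 (par c z.2))) (potential_flow soliton) //.
rewrite -(gradientE oU0 G_sym inverse_metric Ux (@potentialE t))
  -(gmxE oU (metric_smooth g c) t Ux).
have -> : differential d p = grad d gi p *m gK by rewrite /grad -mulmxA inverse_metric mulmx1.
rewrite trmx_mul gmx_sym // mulmxA.
by rewrite /bil map_trmx -!map_mxM mxE.
Qed.

End Soliton.

(** * Moving hypersurfaces in a chart *)

(** The algebraic identity, evaluated by a ring morphism.  It is stated for
    arbitrary matrices so that the morphism is distributed over sums and
    products without looking inside them. *)
Lemma eval_evolution (L : comPzRingType) (R : comPzRingType) m n
    (phi : {rmorphism L -> R}) (Hd H : 'M[L]_1) (dH T : 'rV[L]_m) (A : 'M[L]_m)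
    (E s : 'rV[L]_n) (Rc : 'M[L]_n) (J : 'M[L]_(m, n)) (half : L) :
  Hd - (dH *m T^T + dH *m T^T) + T *m A *m T^T
  + (E *m Rc *m (T *m J)^T + E *m Rc *m (T *m J)^T)
  - half *: (E *m s^T) - H *m (E *m Rc *m E^T) = 0 ->
  forall hd h half' (dH' T' : 'rV[R]_m) A' (E' s' : 'rV[R]_n) Rc' J',
  phi (Hd 0 0) = hd -> phi (H 0 0) = h -> phi half = half' ->
  map_mx phi dH = dH' -> map_mx phi T = T' -> map_mx phi A = A' ->
  map_mx phi E = E' -> map_mx phi s = s' -> map_mx phi Rc = Rc' ->
  map_mx phi J = J' ->
  hd - 2 * (dH' *m T'^T) 0 0 + (T' *m A' *m T'^T) 0 0
  + 2 * (E' *m Rc' *m (T' *m J')^T) 0 0 - half' * (E' *m s'^T) 0 0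
  - h * (E' *m Rc' *m E'^T) 0 0 = 0.
Proof.
move=> e hd h half' dH' T' A' E' s' Rc' J' <- <- <- <- <- <- <- <- <- <-.
have -> : phi (Hd 0 0) = (map_mx phi Hd) 0 0 by rewrite mxE.
have -> : phi (H 0 0) = (map_mx phi H) 0 0 by rewrite mxE.
have mtr p q (B : 'M[L]_(p, q)) : map_mx phi B^T = (map_mx phi B)^T.
  by rewrite map_trmx.
have := congr1 (fun B : 'M[L]_1 => map_mx phi B 0 0) e.
rewrite /= map_mx0 !(map_mxD, map_mxN, map_mxZ, map_mxM, mtr, addmxE, oppmxE).
rewrite (mxE scalemx_key) [(map_mx phi H *m _) 0 0]mxE big_ord1 [RHS]mxE => <-.
ring.
Qed.

Section MovingHypersurface.
Variables (R : realType) (m : nat) (M : manifold R m.+1) (S : manifold R m).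
Variables (g : metric_family M) (f : R -> M -> R) (J : set R) (F : R -> S -> M).
Hypotheses (soliton : gradient_steady_soliton g f).
Hypotheses (mcf : mean_curvature_flow g J F).
Hypothesis mcs : forall t, J t ->
  mean_curvature_soliton (fun c => g c t) (f t) (F t).
Variables (c : chart M) (d : chart S) (O : set (R * 'rV[R]_m)).
Variable e0 : R -> 'rV[R]_m -> 'rV[R]_m.+1.
Hypothesis normal : local_unit_normal g J F c d O e0.

Let oO : open O := normal_open normal.
Let oU0 : open (img c) := @img_open R _ M c.
Local Notation U := [set z : R * 'rV[R]_m.+1 | img c z.2].
Local Notation oU := (@chart_time_open R _ M c).
Local Notation K := (sfun oU).
Local Notation L := (sfun oO).
Local Notation dx := (fun i : 'I_m.+1 => @dsf _ _ _ oU (0, delta_mx 0 i)).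
Local Notation dt := (@dsf _ _ _ oU (1, 0)).
Local Notation dy := (fun i : 'I_m => @dsf _ _ _ oO (0, delta_mx 0 i)).
Local Notation ds := (@dsf _ _ _ oO (1, 0)).
Local Notation gK := (gmx oU (metric_smooth g c)).
Local Notation half := (half_sfun oU).
Local Notation p := (potential soliton c).

Definition immersion (z : R * 'rV[R]_m) : 'rV[R]_m.+1 := rep c d (F z.1) z.2.
Local Notation X := immersion.

Lemma immersion_smooth : smooth_on O X.
Proof. by move=> k; apply: Ck_subset (normal_dom normal) (flow_smooth mcf _ _ _). Qed.
Local Notation sX := immersion_smooth.

Lemma time_smooth : smooth_on O (fst : R * 'rV[R]_m -> R).
Proof. move=> k; exact: Ck_fst. Qed.

Lemma immersion_img z : O z -> U (z.1, X z).
Proof. by move/(normal_dom normal) => [_ [_ hz]]; exists (F z.1 (par d z.2)). Qed.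
Local Notation OU := immersion_img.

Local Notation psi := (pullback oO time_smooth sX OU : {rmorphism K -> L}).
Definition immersion_sf : 'rV[L]_m.+1 := mk_mx oO sX.
Local Notation y := immersion_sf.
Definition normal_sf : 'rV[L]_m.+1 := mk_mx oO (normal_smooth normal).
Local Notation E := normal_sf.
Local Notation jacL := (jac_mx dy y).

Lemma chain_space i a : dy i (psi a) = \sum_k jacL i k * psi (dx k a).
Proof.
rewrite [LHS]dsf_pullback [X in X * _](_ : _ = 0) ?mul0r ?add0r.
  by apply: eq_bigr => k _; rewrite [jac_mx _ _ _ _]mxE.
by apply: ev_inj => z Oz; rewrite dsf_mk derive_fst rmorph0.
Qed.

Lemma chain_time a : ds (psi a) = psi (dt a) + \sum_k ds (y 0 k) * psi (dx k a).
Proof.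
rewrite [LHS]dsf_pullback [X in X * _](_ : _ = 1) ?mul1r //.
by apply: ev_inj => z Oz; rewrite dsf_mk derive_fst rmorph1.
Qed.

Lemma slice_differentiable t u : O (t, u) -> differentiable (rep c d (F t)) u.
Proof.
move=> Otu; have [dX _] := sX 1.
apply: (@differentiable_comp _ _ _ _ (fun u : 'rV[R]_m => (t, u)) X); last exact: dX.
by apply: differentiable_pair; [exact: differentiable_cst|].
Qed.

Lemma jacE t u (Otu : O (t, u)) : map_mx (ev Otu) jacL = 'J (rep c d (F t)) u.
Proof.
apply/row_matrixP => i; rewrite (row_jacobian _ (slice_differentiable Otu)).
rewrite (derive_space X) -(dsf_mk_mx oO sX _ Otu).
by apply/matrixP => a b; rewrite !mxE ord1.
Qed.

Variable gi : 'M[K]_m.+1.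
Hypothesis inverse_metric : gi *m gK = 1%:M.
Local Notation H := (soliton_curvature dx p psi E).

Lemma pullback_metricE z (Oz : O z) :
  map_mx (ev Oz) (map_mx psi gK) = g c z.1 (X z).
Proof. by rewrite pullback_mxE mk_mxE. Qed.

Lemma normal_sf_unit : E *m map_mx psi gK *m E^T = 1%:M.
Proof.
apply: ev_mx_inj => -[t u] Oz; rewrite !map_mxM pullback_metricE -map_trmx mk_mxE map_mx1 /=.
apply/matrixP => a b; rewrite !ord1 [RHS]mxE.
exact: (normal_unit normal Oz).1.
Qed.

Lemma normal_sf_tangent : E *m map_mx psi gK *m jacL^T = 0.
Proof.
apply: ev_mx_inj => -[t u] Oz.
rewrite !map_mxM pullback_metricE -map_trmx mk_mxE map_mx0 jacE /=.
apply/matrixP => a i; rewrite !ord1 [RHS]mxE.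
rewrite -[RHS]((normal_unit normal Oz).2 i) /bil tr_row [RHS]mxE [LHS]mxE.
by apply: eq_bigr => k _; rewrite [col _ _ _ _]mxE.
Qed.

(** The one place where the soliton condition on the hypersurfaces enters. *)
Lemma mean_curvature_sf t u (Otu : O (t, u)) :
  mean_curvature (g c t) (rep c d (F t)) u (e0 t u) = ev Otu (H 0 0).
Proof.
have [Jt dom_u] := normal_dom normal Otu.
have := mcs Jt dom_u (normal_unit normal Otu).
move/eqP; rewrite addr_eq0 => /eqP ->.
have Ux : img c (rep c d (F t) u) := OU Otu.
rewrite (derive_slice (oU := oU) oU0 Ux (f := p) _ (@potentialE _ _ _ _ _ soliton c t)).
rewrite !mxE rmorphN rmorph_sum /=; congr (- _); apply: eq_bigr => k _.
rewrite rmorphM /= !mxE mulrC; congr (_ * _); first by rewrite /ev pullbackE.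
by rewrite /ev mk_sfunE.
Qed.

Lemma flow_sf : map_mx ds y = H *m E.
Proof.
apply: ev_mx_inj => -[t u] Oz; rewrite dsf_mk_mx map_mxM mk_mxE.
have [Jt dom_u] := normal_dom normal Oz.
rewrite -(derive_time X) (flow_equation mcf Jt dom_u (normal_unit normal Oz)).
rewrite mean_curvature_sf; apply/matrixP => a b.
by rewrite !ord1 [RHS]mxE big_ord1 !mxE.
Qed.

Lemma induced_metricE t u (Otu : O (t, u)) :
  map_mx (ev Otu) (jacL *m map_mx psi gK *m jacL^T) =
  induced_metric (g c t) (rep c d (F t)) u.
Proof. by rewrite !map_mxM pullback_metricE -map_trmx jacE. Qed.

Lemma induced_metric_unit t u : O (t, u) ->
  induced_metric (g c t) (rep c d (F t)) u \in unitmx.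
Proof.
move=> Otu; have [Jt dom_u] := normal_dom normal Otu.
apply: posdef_unit => v v0.
have := @metric_posdef _ _ _ g c t _ (OU Otu) (v *m 'J (rep c d (F t)) u).
rewrite /bil /induced_metric trmx_mul !mulmxA; apply.
apply: contraNneq v0 => vJ; apply/eqP.
by apply: (row_free_inj (flow_immersion mcf Jt dom_u)); rewrite vJ mul0mx.
Qed.

Lemma induced_metric_inverse :
  exists hi : 'M[L]_m, hi *m (jacL *m map_mx psi gK *m jacL^T) = 1%:M.
Proof.
apply: inverse_mx => -[t u] Otu; rewrite induced_metricE; exact: induced_metric_unit.
Qed.

Variable hi : 'M[L]_m.
Hypothesis inverse_induced : hi *m (jacL *m map_mx psi gK *m jacL^T) = 1%:M.

(** The components of the tangential gradient of f in the frame J. *)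
Definition tangential : 'rV[L]_m := map_mx psi (differential dx p) *m jacL^T *m hi.
Local Notation T := tangential.

Lemma tangential_split : map_mx psi (grad dx gi p) = T *m jacL - H *m E.
Proof.
have gs : (map_mx psi gK)^T = map_mx psi gK.
  by rewrite map_trmx gmx_sym // => t' x; exact: Defs.metric_sym.
rewrite [LHS](tangent_normal_split (map_mx psi (grad dx gi p))
  normal_sf_unit normal_sf_tangent gs inverse_induced).
have -> : map_mx psi (grad dx gi p) *m map_mx psi gK = map_mx psi (differential dx p).
  by rewrite -map_mxM /grad -mulmxA inverse_metric mulmx1.
by rewrite mulNmx opprK.
Qed.

Section AtPoint.
Variables (t : R) (u : 'rV[R]_m) (Otu : O (t, u)).
Let Ux : img c (rep c d (F t) u) := OU Otu.
Let G := g c t.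
Let h := induced_metric G (rep c d (F t)).

Lemma inverse_inducedE : map_mx (ev Otu) hi = invmx (h u).
Proof.
apply: left_inverse_invmx; have := congr1 (map_mx (ev Otu)) inverse_induced.
by rewrite map_mxM induced_metricE map_mx1.
Qed.

Lemma induced_metric_sym : (h u)^T = h u.
Proof.
by rewrite /h /induced_metric !trmx_mul trmxK mulmxA (Defs.metric_sym g t Ux).
Qed.

Lemma near_slice : \forall v \near u, O (t, v).
Proof.
apply: (@cvg_pair _ _ _ (nbhs u) (nbhs t) (nbhs u) _ _ _ (fun _ => t) id).
- exact: cvg_cst.
- exact: cvg_id.
- exact: (@open_nbhs_nbhs (R * 'rV[R]_m)%type (t, u) O (conj oO Otu)).
Qed.

Lemma pd_slice (q : 'rV[R]_m -> R) (a : L) i : (forall v, O (t, v) -> q v = a (t, v)) ->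
  pd i q u = ev Otu (dy i a).
Proof.
move=> qa; have e : \forall v \near u, q v = a (t, v) by apply: filterS near_slice => v /qa.
by rewrite /pd (near_eq_derive _ e) derive_space /ev (dsfE _ _ Otu).
Qed.

Lemma tangentialE :
  map_mx (ev Otu) T = gradient h (fun v => f t (F t (par d v))) u.
Proof.
rewrite gradient_mul trmx_inv induced_metric_sym -inverse_inducedE map_mxM; congr (_ *m _).
apply/matrixP => a i; rewrite !ord1 [RHS]mxE.
rewrite (@pd_slice _ (psi p)); last first.
  move=> v Ov; rewrite pullbackE //= mk_sfunE; last exact: OU Ov.
  by rewrite /= coordK //; have [_ []] := normal_dom normal Ov.
rewrite chain_space [LHS]mxE [in LHS]mxE !rmorph_sum; apply: eq_bigr => k _.
by rewrite !rmorphM !mxE mulrC.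
Qed.

Lemma d_mean_curvatureE : map_mx (ev Otu) (d_soliton_curvature dx p psi dy E) =
  \row_i pd i (fun v => mean_curvature G (rep c d (F t)) v (e0 t v)) u.
Proof.
apply/matrixP => a i; rewrite 2![in LHS]mxE [RHS]mxE; apply/esym.
by rewrite (@pd_slice _ (H 0 0)) // => v Ov; rewrite (mean_curvature_sf Ov).
Qed.

Lemma cov_derivE i j :
  map_mx (ev Otu) (cov_along dx half gK gi psi (dy i) (row i jacL) (row j jacL)) =
  cov_deriv G (rep c d (F t)) i j u.
Proof.
have jE a b v (Ov : O (t, v)) : 'J (rep c d (F t)) v a b = ev Ov (jacL a b).
  by rewrite -(jacE Ov) mxE.
apply/matrixP => r k; rewrite !ord1 [LHS]mxE [RHS]mxE /cov_along.
rewrite addmxE mul_connection_along rmorphD.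
congr (_ + _).
  by rewrite [map_mx _ _ _ _]mxE [row _ _ _ _]mxE; apply/esym/pd_slice => v Ov; exact: jE.
rewrite rmorph_sum; apply: eq_bigr => a _; rewrite rmorph_sum; apply: eq_bigr => b _.
rewrite 2!rmorphM ![row _ _ _ _]mxE (jE i a) (jE j b) (christoffelE oU0 inverse_metric t Ux k a b).
by congr (_ * _ * _); exact: pullbackE.
Qed.

Lemma pullback_ricciE : map_mx (ev Otu) (map_mx psi (ricci_mx dx half gK gi)) =
  ricci G (rep c d (F t) u).
Proof. by rewrite pullback_mxE (ricciE oU0 inverse_metric t Ux). Qed.

Lemma derive_scalar_curvatureE N : 'D_N (scalar_curvature G) (rep c d (F t) u) =
  (N *m (map_mx (ev Otu) (\row_k psi (dx k (scalar_curv dx half gK gi))))^T) 0 0.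
Proof.
rewrite (derive_slice (oU := oU) oU0 Ux _ (scalar_curvatureE oU0 inverse_metric t)) mxE.
by apply: eq_bigr => k _; rewrite !mxE; congr (_ * _); apply/esym; exact: pullbackE.
Qed.

Lemma second_formE : map_mx (ev Otu) (second_ff dx half gK gi psi dy y E) =
  second_form G (rep c d (F t)) u (e0 t u).
Proof.
apply/matrixP => i j; rewrite [LHS]mxE [in LHS]mxE [RHS]mxE /bil -cov_derivE.
have -> : e0 t u = map_mx (ev Otu) E by rewrite mk_mxE.
have -> : G (rep c d (F t) u) = map_mx (ev Otu) (map_mx psi gK) by rewrite pullback_metricE.
by rewrite map_trmx -!map_mxM [RHS]mxE.
Qed.

Lemma mean_curvature_dtE : (fun s => mean_curvature (g c s) (rep c d (F s)) u (e0 s u))^`() t =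
  ev Otu (ds (H 0 0)).
Proof.
rewrite (derive_time (fun z => mean_curvature (g c z.1) (rep c d (F z.1)) z.2 (e0 z.1 z.2))).
rewrite /ev (dsfE _ _ Otu); apply: (eq_on_derive oO) Otu => -[s v] Osv.
exact: mean_curvature_sf.
Qed.

Lemma evolution_at :
  ((fun s => mean_curvature (g c s) (rep c d (F s)) u (e0 s u))^`() t)%classic
  - 2 * bil (h u) (gradient h (fun v => f t (F t (par d v))) u)
      (gradient h (fun v => mean_curvature G (rep c d (F t)) v (e0 t v)) u)
  + bil (second_form G (rep c d (F t)) u (e0 t u))
      (gradient h (fun v => f t (F t (par d v))) u)
      (gradient h (fun v => f t (F t (par d v))) u)
  + 2 * bil (ricci G (rep c d (F t) u)) (e0 t u)
      (gradient h (fun v => f t (F t (par d v))) u *m 'J (rep c d (F t)) u)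
  - 2^-1 * 'D_(e0 t u) (scalar_curvature G) (rep c d (F t) u)
  - mean_curvature G (rep c d (F t)) u (e0 t u)
    * bil (ricci G (rep c d (F t) u)) (e0 t u) (e0 t u) = 0.
Proof.
have gs : gK^T = gK by apply: gmx_sym => t' x; exact: Defs.metric_sym.
have dD i := @dsf_derivation _ _ _ oU (0, delta_mx 0 i).
have dC (i j : 'I_m.+1) a := @dsfC _ _ _ oU (0, delta_mx 0 i) (0, delta_mx 0 j) a.
have dtC (i : 'I_m.+1) a := @dsfC _ _ _ oU (1, 0) (0, delta_mx 0 i) a.
have eD i := @dsf_derivation _ _ _ oO (0, delta_mx 0 i).
have eC (i : 'I_m) a := @dsfC _ _ _ oO (1, 0) (0, delta_mx 0 i) a.
have evol := hypersurface_evolution dD dC (half_sfun_double oU) gs inverse_metric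
  (soliton_sf soliton inverse_metric) dtC (ricci_flow_sf soliton inverse_metric)
  (potential_flow_sf soliton inverse_metric) eD (@dsf_derivation _ _ _ oO (1, 0)) eC
  chain_space chain_time normal_sf_unit normal_sf_tangent flow_sf tangential_split.
rewrite derive_scalar_curvatureE mean_curvature_dtE mean_curvature_sf.
have hinner v w : bil (h u) v (w *m (invmx (h u))^T) = (w *m v^T) 0 0.
  by rewrite /bil trmx_mul trmxK -mulmxA mulKVmx ?induced_metric_unit // rv_dotC.
rewrite [gradient h (fun v => mean_curvature _ _ _ _) u]gradient_mul hinner.
apply: (eval_evolution evol _ _ _ d_mean_curvatureE tangentialE second_formE
  _ _ pullback_ricciE (jacE Otu)) => //.
- by rewrite mxE.
- by apply: etrans (pullbackE oO time_smooth sX OU _ Otu) _; rewrite mk_sfunE //; exact: OU.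
- by rewrite mk_mxE.
Qed.

End AtPoint.

End MovingHypersurface.

Theorem proposition7 (R : realType) (m : nat)
  (M : manifold R m.+1) (S : manifold R m)
  (g : metric_family M) (f : R -> M -> R) (J : set R) (F : R -> S -> M)
  (soliton : gradient_steady_soliton g f)
  (mcf : mean_curvature_flow g J F)
  (mcs : forall t, J t ->
     mean_curvature_soliton (fun c => g c t) (f t) (F t))
  (c : chart M) (d : chart S) (O : set (R * 'rV[R]_m))
  (e0 : R -> 'rV[R]_m -> 'rV[R]_m.+1)
  (normal : local_unit_normal g J F c d O e0)
  (t : R) (u : 'rV[R]_m) (Otu : O (t, u)) :
  let G := g c t in
  let X := rep c d (F t) in
  let h := induced_metric G X in
  let H := fun s y => mean_curvature (g c s) (rep c d (F s)) y (e0 s y) in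
  let gradf := gradient h (fun y => f t (F t (par d y))) u in
  let gradH := gradient h (H t) u in
  let A := second_form G X u (e0 t u) in
  let Ric := ricci G (X u) in
  let dHdt := (fun s => H s u)^`() t in
  dHdt
  - 2 * bil (h u) gradf gradH
  + bil A gradf gradf
  + 2 * bil Ric (e0 t u) (gradf *m 'J X u)
  - 2^-1 * 'D_(e0 t u) (scalar_curvature G) (X u)
  - H t u * bil Ric (e0 t u) (e0 t u) = 0.
Proof.
move=> /=; have [gi inverse_metric] := metric_inverse g c.
have [hi inverse_induced] := induced_metric_inverse mcf normal.
exact: (evolution_at soliton mcs inverse_metric inverse_induced Otu).
Qed.
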